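(* Let $X\sim ID(b,0,\nu)$ be nondegenerate with $\mathbb{E}|X|^2<\infty$. Let its characteristic function $\varphi$ be such that, for some $C>0$ and $p\ge1$ and for all $t\in\mathbb{R}$, $$|\varphi(t)|\int_0^{|t|}\frac{ds}{|\varphi(s)|}\le C|t|^p,$$ and let the law of $X$ be absolutely continuous with respect to the Lebesgue measure with a bounded density. Let $X_n$, $n\ge1$, be compound Poisson random variables with characteristic functions $$\varphi_n(t)=\exp\left(n\left((\varphi(t))^{\frac1n}-1\right)\right),\qquad t\in\mathbb{R}.$$ Then there is a constant $C'>0$ not depending on $n$ such that for all $n\ge1$ $$d_K(X_n,X)\le C'\left(\frac1n\right)^{\frac{1}{p+4}}\left(|\mathbb{E}X|+\int_{-\infty}^{+\infty}u^2\,\nu(du)\right)^{\frac{2}{p+4}}.$$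
   Context: A Lévy measure is a positive Borel measure $\nu$ on $\mathbb{R}$ with $\nu(\{0\})=0$ and $\int(1\wedge u^2)\nu(du)<\infty$. $X\sim ID(b,0,\nu)$ means that $\nu$ is a Lévy measure and $\varphi(t)=\mathbb{E}e^{itX}=\exp\big(itb+\int(e^{itu}-1-itu\mathbf{1}_{|u|\le1})\nu(du)\big)$ for all $t\in\mathbb{R}$; $(\varphi(t))^{1/n}$ is the exponential of $1/n$ times this exponent. $d_K(X,Y)=\sup_{x\in\mathbb{R}}|\mathbb{P}(X\le x)-\mathbb{P}(Y\le x)|$. *)

(* Defs.v *)
From HB Require Import structures.
From mathcomp Require Export all_boot all_order all_algebra.
From mathcomp Require Export complex.
From mathcomp Require Export all_classical all_reals all_analysis.

Set Implicit Arguments.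
Unset Strict Implicit.
Unset Printing Implicit Defensive.

Import Order.TTheory GRing.Theory Num.Theory.
Import numFieldNormedType.Exports.

Local Open Scope classical_set_scope.
Local Open Scope ring_scope.
Local Open Scope complex_scope.

(* The modulus with values in R; the order-theoretic norm of R[i] has values in
   R[i] itself. *)
Definition cmod (R : realType) (z : R[i]) : R := ComplexField.Normc.normc z.

Definition cexp (R : realType) (z : R[i]) : R[i] :=
  (expR (complex.Re z) * cos (complex.Im z)) +i*
  (expR (complex.Re z) * sin (complex.Im z)).

Definition cintegral (d : measure_display) (T : measurableType d)
    (R : realType) (mu : {measure set T -> \bar R}) (f : T -> R[i]) : R[i] :=
  (\int[mu]_x complex.Re (f x))%R +i* (\int[mu]_x complex.Im (f x))%R.

Definition char_fun (d : measure_display) (T : measurableType d)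
    (R : realType) (P : probability T R) (X : {RV P >-> R}) (t : R) : R[i] :=
  cintegral P (fun w => cexp ('i * (t * X w)%:C)).

Definition levy_measure (R : realType)
    (nu : {measure set (measurableTypeR R) -> \bar R}) : Prop :=
  nu [set 0] = 0%E /\
  (\int[nu]_u (Num.min 1 (u ^+ 2))%:E < +oo)%E.

Definition levy_exponent (R : realType) (b : R)
    (nu : {measure set (measurableTypeR R) -> \bar R}) (t : R) : R[i] :=
  'i * (t * b)%:C +
  cintegral nu (fun u =>
    cexp ('i * (t * u)%:C) - 1
      - 'i * (t * u)%:C * ((`|u| <= 1)%R : nat)%:R).

(* X ~ ID(b, 0, nu) *)
Definition is_ID (d : measure_display) (T : measurableType d)
    (R : realType) (P : probability T R) (X : {RV P >-> R}) (b : R)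
    (nu : {measure set (measurableTypeR R) -> \bar R}) : Prop :=
  levy_measure nu /\
  forall t : R, char_fun X t = cexp (levy_exponent b nu t).

(* phi ^ (1/n), with phi the characteristic function of ID(b, 0, nu): the root
   is taken through the exponent, not through a branch of the logarithm. *)
Definition ID_cf_root (R : realType) (b : R)
    (nu : {measure set (measurableTypeR R) -> \bar R}) (n : nat) (t : R) :
    R[i] :=
  cexp (n%:R^-1 * levy_exponent b nu t).

Definition nondegenerate (d : measure_display) (T : measurableType d)
    (R : realType) (P : probability T R) (X : {RV P >-> R}) : Prop :=
  ~ exists c : R, distribution P X [set c] = 1%E.

Definition has_bounded_density (d : measure_display) (T : measurableType d)
    (R : realType) (P : probability T R) (X : {RV P >-> R}) : Prop :=
  exists f : R -> R,
    [/\ measurable_fun [set: R] f,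
        forall x, 0 <= f x,
        exists M : R, forall x, f x <= M &
        forall A : set R, measurable A ->
          distribution P X A = (\int[lebesgue_measure]_(x in A) (f x)%:E)%E].

(* the k-fold convolution power Q * ... * Q *)
Fixpoint conv_pow (R : realType) (Q : probability (measurableTypeR R) R)
    (k : nat) (A : set R) : \bar R :=
  match k with
  | 0%N => \d_(0 : R) A
  | k'.+1 => (\int[Q]_x conv_pow Q k' [set y | A (x + y)%R])%E
  end.

(* X has the law of Y_1 + ... + Y_N, with N Poisson of rate lambda independent
   of the i.i.d. sequence (Y_k) of law Q. *)
Definition compound_poisson (d : measure_display) (T : measurableType d)
    (R : realType) (P : probability T R) (X : {RV P >-> R}) : Prop :=
  exists (lambda : R) (Q : probability (measurableTypeR R) R),
    0 < lambda /\
    forall A : set R, measurable A ->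
      distribution P X A =
        (\sum_(0 <= k <oo) (poisson_pmf lambda k)%:E * conv_pow Q k A)%E.

(* Kolmogorov distance; X and Y may live on different probability spaces. *)
Definition kolmogorov_dist (R : realType)
    (d : measure_display) (T : measurableType d) (P : probability T R)
    (X : {RV P >-> R})
    (d' : measure_display) (T' : measurableType d') (P' : probability T' R)
    (Y : {RV P' >-> R}) : \bar R :=
  ereal_sup (range (fun x : R => `|cdf X x - cdf Y x|%E)).

(* Main.v *)
(* Let psi be the exponent of X, so that phi_n = exp (n (e^(psi / n) - 1)). On
   the half-plane Re z <= 0 one has |e^z - 1 - z| <= c |z|^2 and
   |e^z - e^w| <= c |z - w|, whence |phi_n - phi| <= c |psi|^2 / n; moreover
   |psi t| <= c (|t| + t^2) as soon as the integral of u^2 against nu is finite.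
   An Esseen-type smoothing inequality turns this into
   d_K (X_n, X) <= c (1 / (n s^4) + s) for every s in ]0, 1], the second term
   coming from the bounded density of X. The choice s = n^(-1/5) gives the rate
   n^(-1/5), which is at least as good as n^(-1/(p+4)) since p >= 1.
   The smoothing kernel is the Cauchy law: its Fourier transform e^(-|t|) kills
   the growth t^2 + t^4, and Fourier inversion reduces to Fubini's theorem and
   the identity atan b - atan a = int_0^oo e^(-t) (sin (tb) - sin (ta)) / t dt.
   The right-hand side of the theorem does not vanish: if the integral of u^2
   is 0, then phi is the characteristic function of the constant b, and letting
   s tend to 0 in the smoothing inequality contradicts the bounded density. *)
From HB Require Import structures.
Require Import Defs.
From mathcomp Require Import measurable_realfun.
From mathcomp Require Import ring lra.

Set Implicit Arguments.
Unset Strict Implicit.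
Unset Printing Implicit Defensive.

Import Order.TTheory GRing.Theory Num.Theory.
Import numFieldNormedType.Exports.

Local Open Scope classical_set_scope.
Local Open Scope ring_scope.
Local Open Scope complex_scope.

(** * Trigonometric and exponential integrals *)

Section elementary_integrals.
Context {R : realType}.
Local Notation leb := (@lebesgue_measure R).
Implicit Types (f F : R -> R) (a b t : R).

Lemma Rintegral_is_derive f F a b : a < b -> continuous f ->
  (forall x : R, is_derive x 1 F (f x)) ->
  \int[leb]_(x in `[a, b]) f x = F b - F a.
Proof.
move=> ab cf dF.
have dF' x : derivable F x 1 by apply: ex_derive.
have cF : continuous F.
  by move=> x; apply/differentiable_continuous/derivable1_diffP.
rewrite /Rintegral (@continuous_FTC2 _ _ F)//.
- exact: continuous_subspaceT.
- by split => //; [exact/cvg_at_right_filter/cF|exact/cvg_at_left_filter/cF].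
- by move=> x _; rewrite derive1E; apply: derive_val.
Qed.

Lemma Rintegral_atan a b : a < b ->
  \int[leb]_(x in `[a, b]) (1 + x ^+ 2)^-1 = atan b - atan a.
Proof.
move=> ab; apply: Rintegral_is_derive => // x.
have h : 1 + x ^+ 2 != 0 by rewrite gt_eqF// ltr_pwDl// sqr_ge0.
apply: cvgV => //; apply: cvgD; first exact: cvg_cst.
exact: exprn_continuous.
Qed.

Lemma Rintegral_cosM a b t : a < b -> t != 0 ->
  \int[leb]_(x in `[a, b]) cos (t * x) = (sin (t * b) - sin (t * a)) / t.
Proof.
move=> ab t0; rewrite mulrBl; apply: (@Rintegral_is_derive _ (fun x => sin (t * x) / t)) => // x.
  apply: (continuous_comp (f := fun x => t * x)); last exact: continuous_cos.
  exact: mulrl_continuous.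
have -> : (fun x => sin (t * x) / t) = t^-1 \*: (@sin R \o (t \*: id)).
  by apply/funext => y /=; rewrite /GRing.scale/= mulrC.
apply: is_derive_eq; rewrite /GRing.scale/=; field.
by [].
Qed.

Lemma integral_expRN (c : R) : 0 < c ->
  (\int[leb]_(t in `]0%R, +oo[) (expR (- (c * t)))%:E = (c^-1)%:E)%E.
Proof.
move=> c0.
have ce : continuous (fun t : R => expR (- (c * t))).
  move=> t; apply: (continuous_comp (f := fun x => - (c * x))); last exact: continuous_expR.
  by apply: cvgN; exact: mulrl_continuous.
rewrite integral_itv_obnd_cbnd; last first.
  apply/measurable_EFinP/measurable_funTS; exact: continuous_measurable_fun.
have dF (t : R) : is_derive t 1 (fun t => - expR (- (c * t)) / c) (expR (- (c * t))).
  have -> : (fun t => - expR (- (c * t)) / c) = (- c^-1) \*: (@expR R \o (- (c \*: id))).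
    by apply/funext => y /=; rewrite /GRing.scale/= mulNr mulNr mulrC.
  apply: is_derive_eq; rewrite /GRing.scale/=; field.
  exact: lt0r_neq0.
rewrite (@ge0_continuous_FTC2y _ _ (fun t => - expR (- (c * t)) / c) _ 0)//=.
- by rewrite mulr0 oppr0 expR0 mulNr mul1r opprK add0r.
- exact: continuous_subspaceT.
- rewrite -[X in _ --> X](mul0r c^-1) -oppr0; apply: cvgMl; apply: cvgN.
  apply: (@cvg_comp _ _ _ (fun x => c * x) (fun x => expR (- x)) _ (pinfty_nbhs R));
    last exact: cvgr_expR.
  exact: gt0_cvgMry.
- apply: cvg_at_right_filter.
  by apply: cvgMl; apply: cvgN; exact: ce.
- by move=> x _; rewrite derive1E; apply: derive_val.
Qed.

Lemma integrable_expRN (c : R) : 0 < c ->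
  leb.-integrable `]0%R, +oo[ (fun t => (expR (- (c * t)))%:E).
Proof.
move=> c0; apply/integrableP; split.
  apply/measurable_EFinP/measurable_funTS; apply: continuous_measurable_fun.
  move=> t; apply: (continuous_comp (f := fun x => - (c * x))); last exact: continuous_expR.
  by apply: cvgN; exact: mulrl_continuous.
under eq_integral do rewrite gee0_abs ?lee_fin ?expR_ge0//.
by rewrite integral_expRN// ltry.
Qed.

Lemma measurable_sin : measurable_fun [set: R] (@sin R).
Proof. by apply: continuous_measurable_fun; exact: continuous_sin. Qed.

Lemma measurable_cos : measurable_fun [set: R] (@cos R).
Proof. by apply: continuous_measurable_fun; exact: continuous_cos. Qed.

Lemma measurable_atan : measurable_fun [set: R] (@atan R).
Proof. by apply: continuous_measurable_fun; exact: continuous_atan. Qed.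

Lemma measurable_expRN : measurable_fun [set: R] (fun t : R => expR (- t)).
Proof. by apply: measurableT_comp => //; exact: measurable_funN. Qed.

Lemma integrable_expRN1 :
  leb.-integrable `]0%R, +oo[ (EFin \o (fun t : R => expR (- t))).
Proof.
have := integrable_expRN (@ltr01 R).
by apply: eq_integrable => // t _; rewrite mul1r.
Qed.

(* The integrand changes sign, which the FTC on a half-line does not allow:
   the proof integrates e^(-t) (1 + cos (t s)) >= 0 instead. *)
Lemma cos_exponential s :
  \int[leb]_(t in `]0%R, +oo[) (expR (- t) * cos (t * s)) = (1 + s ^+ 2)^-1.
Proof.
have s20 : 1 + s ^+ 2 != 0 by rewrite gt_eqF// ltr_pwDl// sqr_ge0.
have ie := integrable_expRN1.
have ic : leb.-integrable `]0%R, +oo[ (fun t : R => (expR (- t) * cos (t * s))%:E).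
  apply: le_integrable ie => //.
    apply/measurable_EFinP/measurable_funTS/measurable_funM.
      exact: measurable_expRN.
    by apply: (measurableT_comp measurable_cos); exact: measurable_funM.
  move=> t _ /=; rewrite lee_fin normrM ger_pMr ?cos_max// normr_gt0.
  by rewrite gt_eqF// expR_gt0.
(* [F] is an antiderivative of e^(-t) (1 + cos (t s)): the quotient accounts for the cosine and the
   -1 for the constant. It vanishes at infinity, so the integral over the half-line is [- F 0]. *)
pose F (t : R) := expR (- t) * ((s * sin (t * s) - cos (t * s)) / (1 + s ^+ 2) - 1).
have ce : continuous (fun t : R => expR (- t) * (1 + cos (t * s))).
  move=> t; apply: cvgM.
    apply: (continuous_comp (f := fun x => - x)); last exact: continuous_expR.
    exact: oppr_continuous.
  apply: cvgD; first exact: cvg_cst.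
  apply: (@continuous_comp _ _ _ (fun x : R => x * s) (@cos R) t); last exact: continuous_cos.
  exact: mulrr_continuous.
have dF (t : R) : is_derive t 1 F (expR (- t) * (1 + cos (t * s))).
  have -> : F = (@expR R \o -%R) *
      ((1 + s ^+ 2)^-1 \*: (s \*: (@sin R \o (s \*: id)) - (@cos R \o (s \*: id))) - cst 1).
    apply/funext => y; rewrite !fctE /F /= /GRing.scale/= -![s * y]mulrC.
    by congr (_ * (_ - _)); rewrite [LHS]mulrC.
  apply: is_derive_eq; rewrite !fctE /= /GRing.scale/= -![s * t]mulrC; field.
  exact: s20.
have Fy : F x @[x --> +oo%R] --> 0.
  pose K := (`|s| + 1) / (1 + s ^+ 2) + 1.
  have eK : expR (- t) * K @[t --> +oo%R] --> 0.
    by rewrite -[X in _ --> X](mul0r K); apply: cvgMl; exact: cvgr_expR.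
  have FK t : `|F t| <= expR (- t) * K.
    rewrite normrM ger0_norm ?expR_ge0// ler_wpM2l ?expR_ge0//.
    rewrite (le_trans (ler_normB _ _))// normr1 lerD2r normrM.
    rewrite [X in _ * X]ger0_norm ?invr_ge0 ?addr_ge0 ?sqr_ge0//.
    rewrite ler_wpM2r ?invr_ge0 ?addr_ge0 ?sqr_ge0//.
    rewrite (le_trans (ler_normB _ _))// lerD ?cos_max// normrM.
    by rewrite ler_piMr// sin_max.
  apply: (@squeeze_cvgr _ _ _ _ (fun t => - (expR (- t) * K)) (fun t => expR (- t) * K)) => //.
    by near=> t; rewrite -ler_norml.
  by rewrite -[X in _ --> X]oppr0; exact: cvgN.
have ies : leb.-integrable `]0%R, +oo[ (fun t : R => (expR (- t) + expR (- t) * cos (t * s))%:E).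
  by refine (integrableD _ ie ic); exact: measurable_itv.
have key : \int[leb]_(t in `]0%R, +oo[) (expR (- t) + expR (- t) * cos (t * s))
    = 1 + (1 + s ^+ 2)^-1.
  have eE : (fun t => expR (- t) + expR (- t) * cos (t * s)) =
      (fun t => expR (- t) * (1 + cos (t * s))).
    by apply/funext => t; rewrite mulrDr mulr1.
  rewrite Rintegral_itv_obnd_cbnd; last exact: ies.
  rewrite eE.
  have F0 : F 0 = - (1 + s ^+ 2)^-1 - 1.
    by rewrite /F oppr0 expR0 mul0r sin0 cos0 mulr0 sub0r mul1r mulN1r.
  have fge0 t : 0 <= t -> 0 <= expR (- t) * (1 + cos (t * s)).
    by move=> _; rewrite mulr_ge0 ?expR_ge0// -lerBlDl sub0r cos_geN1.
  have F0r : F x @[x --> 0^'+] --> F 0.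
    apply: cvg_at_right_filter; apply/differentiable_continuous/derivable1_diffP.
    exact: ex_derive.
  have F' : {in `]0, +oo[, F^`()%classic =1 (fun t => expR (- t) * (1 + cos (t * s)))}.
    by move=> x _; rewrite derive1E; apply: derive_val.
  have dF1 x : 0 < x -> derivable F x 1 by move=> _; apply: ex_derive.
  rewrite (Rintegral_ge0_continuous_FTC2y fge0 (continuous_subspaceT ce) Fy dF1 F0r F').
  by rewrite F0 sub0r opprB opprK.
have key2 : \int[leb]_(t in `]0%R, +oo[) (expR (- t)) = 1.
  transitivity (fine (\int[leb]_(t in `]0%R, +oo[) (expR (- (1 * t)))%:E)%E).
    by congr fine; apply: eq_integral => t _; rewrite mul1r.
  by rewrite integral_expRN//= invr1.
by move: key; rewrite RintegralD// key2 => /addrI.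
Unshelve. all: by end_near. Qed.

End elementary_integrals.

(** * Fubini's theorem for real-valued integrals *)

Section integrable_prod_le.
Context {R : realType} d1 d2 (T1 : measurableType d1) (T2 : measurableType d2).
Variables (m1 : {sigma_finite_measure set T1 -> \bar R}).
Variables (m2 : {sigma_finite_measure set T2 -> \bar R}).

(** Under a product bound, Tonelli's iterated integral of |f| is at most the product of the
    integrals of |v| and |w|, both finite. *)
Lemma integrable_prod_le (f : T1 * T2 -> R) (v : T1 -> R) (w : T2 -> R) :
  measurable_fun setT f ->
  m1.-integrable setT (EFin \o v) -> m2.-integrable setT (EFin \o w) ->
  (forall x y, `|f (x, y)| <= v x * w y) ->
  (m1 \x m2)%E.-integrable setT (EFin \o f).
Proof.
move=> mf iv iw fvw.
have mv : measurable_fun setT v by apply/measurable_EFinP; case/integrableP : iv.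
have mw : measurable_fun setT w by apply/measurable_EFinP; case/integrableP : iw.
have [_ wfin] := integrableP _ _ _ iw; have [_ vfin] := integrableP _ _ _ iv.
have mef : measurable_fun setT (EFin \o f) by exact/measurable_EFinP.
apply/(integrable12ltyP m1 m2 mef).
apply: (@le_lt_trans _ _ (\int[m1]_x (`|(v x)%:E| * \int[m2]_y `|(w y)%:E|))%E).
  apply: ge0_le_integral => //.
  - by move=> x _; exact: integral_ge0.
  - apply: (measurable_fun_fubini_tonelli_F (fun z => `|(EFin \o f) z|%E)) => //.
    exact: measurableT_comp.
  - apply: emeasurable_funM => //; apply: measurableT_comp => //.
    exact/measurable_EFinP.
  move=> x _; rewrite -ge0_integralZl//; last first.
    by apply: measurableT_comp => //; exact/measurable_EFinP.
  apply: ge0_le_integral => //.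
  - by apply: measurableT_comp => //; apply/measurable_EFinP/measurableT_comp.
  - apply: emeasurable_funM => //; apply: measurableT_comp => //.
    exact/measurable_EFinP.
  - by move=> y _; rewrite /= -EFinM lee_fin -normrM (le_trans (fvw x y))// ler_norm.
rewrite ge0_integralZr//; last 2 first.
  by apply: measurableT_comp => //; exact/measurable_EFinP.
  exact: integral_ge0.
apply: lte_mul_pinfty => //; first exact: integral_ge0.
by rewrite ge0_fin_numE//; exact: integral_ge0.
Qed.

End integrable_prod_le.

Section Rintegral_Fubini.
Context {R : realType} d1 d2 (T1 : measurableType d1) (T2 : measurableType d2).
Variables (m1 : {sigma_finite_measure set T1 -> \bar R}).
Variables (m2 : {sigma_finite_measure set T2 -> \bar R}).

(** The bound holds at every point, so every section is integrable, not just almost every one, and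
    the real-valued inner integrals agree everywhere with the extended ones. Integrability of the
    inner integral is kept because differences of such integrals are taken later. *)
Lemma Rintegral_FubiniT (f : T1 * T2 -> R) (v : T1 -> R) (w : T2 -> R) :
  measurable_fun setT f ->
  m1.-integrable setT (EFin \o v) -> m2.-integrable setT (EFin \o w) ->
  (forall x y, `|f (x, y)| <= v x * w y) ->
  m2.-integrable setT (fun y => (\int[m1]_x f (x, y))%:E) /\
  \int[m1]_x \int[m2]_y f (x, y) = \int[m2]_y \int[m1]_x f (x, y).
Proof.
move=> mf iv iw fvw; have fi := integrable_prod_le mf iv iw fvw.
have i1 x : m2.-integrable setT (EFin \o (fun y => f (x, y))).
  apply: (@le_integrable _ _ _ _ _ _ _ (EFin \o (fun y => v x * w y))) => //.
  - exact/measurable_EFinP/measurableT_comp.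
  - by move=> y _ /=; rewrite lee_fin (le_trans (fvw x y))// ler_norm.
  - exact: (integrableZl measurableT (v x) iw).
have i2 y : m1.-integrable setT (EFin \o (fun x => f (x, y))).
  apply: (@le_integrable _ _ _ _ _ _ _ (EFin \o (fun x => v x * w y))) => //.
  - exact/measurable_EFinP/measurableT_comp.
  - by move=> x _ /=; rewrite lee_fin (le_trans (fvw x y))// ler_norm.
  - exact: (integrableZr measurableT (w y) iv).
have e1 x : (\int[m2]_y f (x, y))%:E = (\int[m2]_y (f (x, y))%:E)%E.
  by rewrite /Rintegral fineK//; exact: (integrable_fin_num _ (i1 x)).
have e2 y : (\int[m1]_x f (x, y))%:E = (\int[m1]_x (f (x, y))%:E)%E.
  by rewrite /Rintegral fineK//; exact: (integrable_fin_num _ (i2 y)).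
split.
  (* Partial integration is over the second coordinate, hence the exchange of the two
     coordinates. *)
  have fi' : (m2 \x m1)%E.-integrable setT (EFin \o (fun z => f (z.2, z.1))).
    apply: (integrable_prod_le _ iw iv) => [|x y /=].
      exact: (measurableT_comp mf (@measurable_swap _ _ _ _)).
    by rewrite mulrC.
  by under eq_fun do rewrite e2; exact: (integrable_fubini_F fi').
rewrite [LHS]/Rintegral [RHS]/Rintegral; congr fine.
under eq_integral do rewrite e1; under [RHS]eq_integral do rewrite e2.
exact: (Fubini fi).
Qed.

(** Extending [f], [v] and [w] by zero outside the domains reduces this to the whole spaces. *)
Lemma Rintegral_Fubini (D1 : set T1) (D2 : set T2)
    (f : T1 * T2 -> R) (v : T1 -> R) (w : T2 -> R) :
  measurable D1 -> measurable D2 -> measurable_fun setT f ->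
  m1.-integrable D1 (EFin \o v) -> m2.-integrable D2 (EFin \o w) ->
  (forall x y, D1 x -> D2 y -> `|f (x, y)| <= v x * w y) ->
  m2.-integrable D2 (fun y => (\int[m1]_(x in D1) f (x, y))%:E) /\
  \int[m1]_(x in D1) \int[m2]_(y in D2) f (x, y) =
  \int[m2]_(y in D2) \int[m1]_(x in D1) f (x, y).
Proof.
move=> mD1 mD2 mf iv iw fvw.
pose g (z : T1 * T2) := \1_D1 z.1 * (\1_D2 z.2 * f z).
have mg : measurable_fun setT g.
  apply: measurable_funM.
    exact: (measurableT_comp (measurable_indic mD1) measurable_fst).
  apply: measurable_funM => //.
  exact: (measurableT_comp (measurable_indic mD2) measurable_snd).
have iv' : m1.-integrable setT (EFin \o (v \_ D1)).
  by rewrite -restrict_EFin; exact/(integrable_mkcond _ mD1).1.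
have iw' : m2.-integrable setT (EFin \o (w \_ D2)).
  by rewrite -restrict_EFin; exact/(integrable_mkcond _ mD2).1.
have gvw x y : `|g (x, y)| <= (v \_ D1) x * (w \_ D2) y.
  rewrite /g/= !patchE !indicE; case: ifPn => xD1; last by rewrite !mul0r normr0.
  case: ifPn => yD2; last by rewrite mul0r !mulr0 normr0.
  by rewrite !mul1r fvw//; exact: set_mem.
have [ig eg] := Rintegral_FubiniT mg iv' iw' gvw.
have gE y : \int[m1]_x g (x, y) = \1_D2 y * \int[m1]_(x in D1) f (x, y).
  rewrite indicE; case: (boolP (y \in D2)) => yD2.
    rewrite mul1r [in RHS]Rintegral_mkcond; apply: eq_Rintegral => x _.
    rewrite /g/= !indicE yD2 mul1r patchE.
    by case: ifPn => _; rewrite ?mul1r ?mul0r.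
  rewrite mul0r (@eq_Rintegral _ _ _ _ _ (fun=> 0)) ?Rintegral_cst ?mul0r// => x _.
  by rewrite /g/= !indicE (negbTE yD2) mul0r mulr0.
have gE' x : \int[m2]_y g (x, y) = \1_D1 x * \int[m2]_(y in D2) f (x, y).
  rewrite indicE; case: (boolP (x \in D1)) => xD1.
    rewrite mul1r [in RHS]Rintegral_mkcond; apply: eq_Rintegral => y _.
    rewrite /g/= !indicE xD1 mul1r patchE.
    by case: ifPn => _; rewrite ?mul1r ?mul0r.
  rewrite mul0r (@eq_Rintegral _ _ _ _ _ (fun=> 0)) ?Rintegral_cst ?mul0r// => y _.
  by rewrite /g/= !indicE (negbTE xD1) mul0r.
split.
  apply/(integrable_mkcond _ mD2).2; apply: eq_integrable ig => // y _.
  rewrite patchE gE indicE.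
  by case: ifPn => _; rewrite ?mul1r ?mul0r.
rewrite Rintegral_mkcond [RHS]Rintegral_mkcond.
under eq_Rintegral => x _.
  rewrite (_ : patch _ _ _ _ = \int[m2]_y g (x, y)); last first.
    by rewrite gE' patchE indicE; case: ifPn => _; rewrite ?mul1r ?mul0r.
  over.
rewrite eg; apply: eq_Rintegral => y _.
by rewrite gE patchE indicE; case: ifPn => _; rewrite ?mul1r ?mul0r.
Qed.

End Rintegral_Fubini.

(** * The Fourier representation of the Cauchy kernel *)

Section Cauchy_transform.
Context {R : realType}.
Local Notation leb := (@lebesgue_measure R).
Implicit Types (a b t : R).

Lemma derive_le_lipschitz (F f : R -> R) (K : R) :
  (forall x : R, is_derive x 1 F (f x)) -> (forall x, `|f x| <= K) ->
  forall a b, `|F b - F a| <= K * `|b - a|.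
Proof.
move=> dF fK a b.
wlog ab : a b / a < b => [H|].
  case: (ltgtP a b) => [|ba|->]; first exact: H.
    by rewrite distrC [X in _ * X]distrC; exact: H.
  by rewrite !subrr normr0 mulr0.
have cF : {within `[a, b], continuous F}.
  apply: continuous_subspaceT => x.
  by apply/differentiable_continuous/derivable1_diffP; apply: ex_derive.
have [c _ ->] := MVT ab (fun x _ => dF x) cF.
by rewrite normrM ler_wpM2r.
Qed.

Lemma sin_lipschitz a b : `|sin b - sin a| <= `|b - a|.
Proof.
rewrite -[leRHS]mul1r; apply: (@derive_le_lipschitz (@sin R) (@cos R)).
by move=> x; exact: cos_max.
Qed.

Lemma cos_lipschitz a b : `|cos b - cos a| <= `|b - a|.
Proof.
rewrite -[leRHS]mul1r; apply: (@derive_le_lipschitz (@cos R) (fun x => - sin x)).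
by move=> x; rewrite normrN sin_max.
Qed.

(** The derivative 1 / (1 + s^2) of atan is replaced by the integral of [cos_exponential]; after
    exchanging the integrals, only the integral of cos (t s) over [a, b] remains. *)
Lemma atan_frequency a b : a < b ->
  \int[leb]_(t in `]0%R, +oo[) (expR (- t) * ((sin (t * b) - sin (t * a)) / t)) =
  atan b - atan a.
Proof.
move=> ab; rewrite -Rintegral_atan//.
transitivity (\int[leb]_(s in `[a, b])
    \int[leb]_(t in `]0%R, +oo[) (expR (- t) * cos (t * s))); last first.
  by apply: eq_Rintegral => s _; exact: cos_exponential.
pose f (z : R * R) := expR (- z.2) * cos (z.2 * z.1).
have mf : measurable_fun [set: R * R] f.
  apply: measurable_funM; first exact: (measurableT_comp measurable_expRN measurable_snd).
  apply: (measurableT_comp measurable_cos).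
  by apply: measurable_funM; [exact: measurable_snd|exact: measurable_fst].
have i1 : leb.-integrable `[a, b] (EFin \o (fun _ : R => 1 : R)).
  apply: continuous_compact_integrable; first exact: segment_compact.
  by apply: continuous_subspaceT => x; exact: cvg_cst.
have := Rintegral_Fubini (m1 := leb) (m2 := leb) (f := f) (measurable_itv _)
  (measurable_itv _) mf i1 integrable_expRN1.
case.
  move=> x y _ _; rewrite /f/= mul1r normrM ger0_norm ?expR_ge0//.
  by rewrite ler_piMr ?expR_ge0// cos_max.
move=> _ ->; apply: eq_Rintegral => t; rewrite inE/= in_itv/= andbT => t0.
rewrite /f/= RintegralZl//; first by rewrite Rintegral_cosM// gt_eqF.
apply: continuous_compact_integrable; first exact: segment_compact.
apply: continuous_subspaceT => x.
apply: (@continuous_comp _ _ _ (fun x : R => t * x) (@cos R) x); last exact: continuous_cos.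
exact: mulrl_continuous.
Qed.

Section expectation.
Context d (T : measurableType d) (P : probability T R) (Y : T -> R).
Hypothesis mY : measurable_fun setT Y.

Lemma integrable_bounded (f : T -> R) (K : R) : measurable_fun setT f ->
  (forall x, `|f x| <= K) -> P.-integrable setT (EFin \o f).
Proof.
move=> mf fK; apply: measurable_bounded_integrable => //.
  by apply: (le_lt_trans (probability_le1 _ _)) => //; exact: ltry.
exists K; split; first exact: num_real.
by move=> x Kx y _; exact: le_trans (fK y) (ltW Kx).
Qed.

(* At t = 0 the division gives 0; only t > 0 matters below. *)
Definition freq_diff a b t (y : R) :=
  expR (- t) * ((sin (t * (b - y)) - sin (t * (a - y))) / t).

(** The subtraction formula for the sine separates [Y] from the endpoints: the law of [Y] enters
    only through the real and imaginary parts of its characteristic function at [t]. *)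
Lemma expectation_freq_diff a b t :
  \int[P]_w freq_diff a b t (Y w) =
  expR (- t) * (((sin (t * b) - sin (t * a)) * \int[P]_w cos (t * Y w)
    - (cos (t * b) - cos (t * a)) * \int[P]_w sin (t * Y w)) / t).
Proof.
have mtY : measurable_fun setT (fun w => t * Y w) by exact: measurable_funM.
have ic : P.-integrable setT (EFin \o (fun w => cos (t * Y w))).
  apply: (@integrable_bounded _ 1) => [|w]; last exact: cos_max.
  exact: (measurableT_comp measurable_cos).
have isn : P.-integrable setT (EFin \o (fun w => sin (t * Y w))).
  apply: (@integrable_bounded _ 1) => [|w]; last exact: sin_max.
  exact: (measurableT_comp measurable_sin).
have ic' k : P.-integrable setT (EFin \o (fun w => k * cos (t * Y w))).
  exact: (integrableZl measurableT k ic).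
have is' k : P.-integrable setT (EFin \o (fun w => k * sin (t * Y w))).
  exact: (integrableZl measurableT k isn).
have ib := integrableB measurableT (ic' (sin (t * b) - sin (t * a)))
  (is' (cos (t * b) - cos (t * a))).
rewrite -RintegralZl// -RintegralZl// -RintegralB// -RintegralZr//.
rewrite -RintegralZl//; last by have := integrableZr measurableT t^-1 ib.
apply: eq_Rintegral => w _; rewrite /freq_diff !mulrBr !sinB; congr (_ * (_ / _)).
ring.
Qed.

(** This is [atan_frequency] between the random endpoints a - Y and b - Y, followed by Fubini's
    theorem. *)
Lemma expectation_atan a b : a < b ->
  leb.-integrable `]0%R, +oo[ (fun t => (\int[P]_w freq_diff a b t (Y w))%:E) /\
  \int[P]_w (atan (b - Y w) - atan (a - Y w)) =
  \int[leb]_(t in `]0%R, +oo[) \int[P]_w freq_diff a b t (Y w).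
Proof.
move=> ab.
(* The factor 1 / t is written as a power, whose measurability is known; the two agree for t > 0,
   the range of integration. *)
pose f (z : T * R) := expR (- z.2) *
  ((sin (z.2 * (b - Y z.1)) - sin (z.2 * (a - Y z.1))) * z.2 `^ (-1)).
have fE w t : `]0%R, +oo[%classic t -> f (w, t) = freq_diff a b t (Y w).
  by rewrite /= in_itv/= andbT => t0; rewrite /f/= powR_inv1// ltW.
have ms c : measurable_fun [set: T * R] (fun z => sin (z.2 * (c - Y z.1))).
  apply: (measurableT_comp measurable_sin).
  apply: measurable_funM; first exact: measurable_snd.
  apply: measurable_funB => //.
  exact: (measurableT_comp mY measurable_fst).
have mf : measurable_fun [set: T * R] f.
  apply: measurable_funM; first exact: (measurableT_comp measurable_expRN measurable_snd).
  apply: measurable_funM; first exact: measurable_funB.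
  exact: (measurableT_comp (measurable_powR (-1)) measurable_snd).
have i1 : P.-integrable setT (EFin \o (fun _ : T => b - a)).
  by apply: (@integrable_bounded _ `|b - a|) => //.
have [|i2 e] := Rintegral_Fubini (m1 := P) (m2 := leb) (f := f) measurableT
  (measurable_itv _) mf i1 integrable_expRN1.
  (* The sine is 1-Lipschitz, so the difference of sines is at most t (b - a); this cancels the
     singularity 1 / t and leaves the bound (b - a) e^(-t). *)
  move=> w t _ ht; rewrite fE//.
  move: ht; rewrite /= in_itv/= andbT => t0.
  rewrite /freq_diff normrM ger0_norm ?expR_ge0// mulrC.
  rewrite ler_wpM2r ?expR_ge0// normrM [X in _ * X]ger0_norm ?invr_ge0 ?(ltW t0)//.
  rewrite ler_pdivrMr//; apply: (le_trans (sin_lipschitz _ _)).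
  rewrite -mulrBr opprB addrA subrK normrM [`|t|]gtr0_norm// mulrC.
  by rewrite ler_wpM2r ?(ltW t0)// gtr0_norm// subr_gt0.
have i3 : leb.-integrable `]0%R, +oo[ (fun t => (\int[P]_w freq_diff a b t (Y w))%:E).
  apply: eq_integrable i2 => // t; rewrite inE => ht; congr EFin.
  by apply: eq_Rintegral => w _; rewrite fE.
split => //.
transitivity (\int[P]_w \int[leb]_(t in `]0%R, +oo[) f (w, t)).
  apply: eq_Rintegral => w _; rewrite -atan_frequency ?ltrD2r//.
  by apply: eq_Rintegral => t; rewrite inE => ht; rewrite fE.
rewrite e; apply: eq_Rintegral => t; rewrite inE => ht.
by apply: eq_Rintegral => w _; rewrite fE.
Qed.

Lemma integrable_atanB c : P.-integrable setT (EFin \o (fun w => atan (c - Y w))).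
Proof.
apply: (@integrable_bounded _ (pi / 2)) => [|w].
  by apply: (measurableT_comp measurable_atan); exact: measurable_funB.
by rewrite ler_norml !ltW ?atan_gtNpi2 ?atan_ltpi2.
Qed.

(** Dominated convergence with the constant bound pi / 2. It lets the left endpoint of a difference
    of atan go to -oo. *)
Lemma cvg_expectation_atan :
  \int[P]_w (atan (- n%:R - Y w)) @[n --> \oo] --> - (pi / 2).
Proof.
have [] := @dominated_convergence _ _ _ P setT measurableT
   (fun n w => (atan (- n%:R - Y w))%:E) (fun=> (- (pi / 2))%:E)
   (fun=> (pi / 2)%:E).
- by move=> n; case/integrableP: (integrable_atanB (- n%:R)).
- by [].
- apply: aeW => w _; apply: cvg_EFin; first exact: nearW.
  rewrite [X in X @ _](_ : _ = - (atan \o (fun n => n%:R + Y w))); last first.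
    by apply/funext => n; rewrite /= fctE -opprD atanN.
  apply: cvgN; apply: (cvg_comp _ _ _ (@cvgy_atan R)).
  apply/cvgryPge => A; near=> n.
  by rewrite -lerBlDr; near: n; exact: nbhs_infty_ger.
- by apply: (@integrable_bounded _ `|pi / 2|).
- apply: aeW => w n _; rewrite lee_fin.
  by rewrite ler_norml !ltW ?atan_gtNpi2 ?atan_ltpi2.
move=> _ _; rewrite integral_cst//= probability_setT mule1 => h.
exact: (fine_cvg h).
Unshelve. all: by end_near. Qed.

End expectation.
End Cauchy_transform.

(** * Comparison of two Cauchy-smoothed laws through their characteristic functions *)

Section Cauchy_transform_comparison.
Context {R : realType}.
Local Notation leb := (@lebesgue_measure R).
Context d1 (T1 : measurableType d1) (P1 : probability T1 R) (Y1 : T1 -> R).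
Context d2 (T2 : measurableType d2) (P2 : probability T2 R) (Y2 : T2 -> R).
Hypotheses (mY1 : measurable_fun setT Y1) (mY2 : measurable_fun setT Y2).
Variable eps : R.
Hypothesis eps0 : 0 <= eps.
Hypothesis cos_close : forall t, 0 < t ->
  `|\int[P1]_w cos (t * Y1 w) - \int[P2]_w cos (t * Y2 w)| <= eps * (t ^+ 2 + t ^+ 4).
Hypothesis sin_close : forall t, 0 < t ->
  `|\int[P1]_w sin (t * Y1 w) - \int[P2]_w sin (t * Y2 w)| <= eps * (t ^+ 2 + t ^+ 4).

(** The inequality 1 + x <= e^x is cubed at x = t / 6, and 216 = 6^3 makes the coefficient of t^3
    equal to 1. Half of the exponential decay thus absorbs the growth (t^2 + t^4) / t. *)
Lemma addr_cube_le_expR (t : R) : 0 <= t -> t + t ^+ 3 <= 216 * expR (2^-1 * t).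
Proof.
move=> t0.
have -> : expR (2^-1 * t) = expR (t / 6) ^+ 3.
  by rewrite -expRM_natl; congr expR; field.
have h : (1 + t / 6) ^+ 3 <= expR (t / 6) ^+ 3.
  by apply: lerXn2r; rewrite ?nnegrE ?expR_ge0 ?expR_ge1Dx ?addr_ge0 ?divr_ge0.
apply: (@le_trans _ _ (216 * (1 + t / 6) ^+ 3)); last by rewrite ler_wpM2l.
have -> : 216 * (1 + t / 6) ^+ 3 = 216 + 108 * t + 18 * t ^+ 2 + t ^+ 3 by field.
rewrite lerD2r; have := sqr_ge0 t; lra.
Qed.

(** The differences of sines and of cosines at the endpoints are at most 2 in absolute value, which
    gives 4 eps (t^2 + t^4) / t; then 864 is 4 times the 216 of [addr_cube_le_expR]. *)
Lemma expectation_freq_diff_close a b t : 0 < t ->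
  `|\int[P1]_w freq_diff a b t (Y1 w) - \int[P2]_w freq_diff a b t (Y2 w)|
  <= 864 * eps * expR (- (2^-1 * t)).
Proof.
move=> t0; rewrite !expectation_freq_diff//.
set S := sin _ - _; set C := cos _ - _.
set u1 := \int[P1]_w cos _; set v1 := \int[P1]_w sin _.
set u2 := \int[P2]_w cos _; set v2 := \int[P2]_w sin _.
have S2 : `|S| <= 2.
  by rewrite (le_trans (ler_normB _ _))// (_ : 2 = 1 + 1)// lerD ?sin_max.
have C2 : `|C| <= 2.
  by rewrite (le_trans (ler_normB _ _))// (_ : 2 = 1 + 1)// lerD ?cos_max.
have -> : expR (- t) * ((S * u1 - C * v1) / t) - expR (- t) * ((S * u2 - C * v2) / t) =
    expR (- t) * ((S * (u1 - u2) - C * (v1 - v2)) / t) by ring.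
have -> : expR (- (2^-1 * t)) = expR (- t) * expR (2^-1 * t).
  by rewrite -expRD; congr expR; field.
rewrite normrM ger0_norm ?expR_ge0// mulrCA ler_wpM2l ?expR_ge0//.
rewrite normrM [X in _ * X]ger0_norm ?invr_ge0 ?(ltW t0)// ler_pdivrMr//.
rewrite (le_trans (ler_normB _ _))// !normrM.
apply: (@le_trans _ _ (2 * (eps * (t ^+ 2 + t ^+ 4)) + 2 * (eps * (t ^+ 2 + t ^+ 4)))).
  by apply: lerD; apply: ler_pM => //; [exact: cos_close|exact: sin_close].
have h := addr_cube_le_expR (ltW t0).
have et : 0 <= eps * t by rewrite mulr_ge0// ltW.
have := ler_wpM2l et h.
set E := expR _ => h'.
have -> : 2 * (eps * (t ^+ 2 + t ^+ 4)) + 2 * (eps * (t ^+ 2 + t ^+ 4)) =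
  4 * (eps * t * (t + t ^+ 3)) by ring.
have -> : 864 * eps * E * t = 4 * (eps * t * (216 * E)) by ring.
by rewrite ler_wpM2l.
Qed.

(** The integral of e^(-t/2) over the half-line is 2, hence 1728 = 2 x 864. The bound is uniform in
    the endpoints. *)
Lemma expectation_atanB_close a b : a < b ->
  `|\int[P1]_w (atan (b - Y1 w) - atan (a - Y1 w)) -
    \int[P2]_w (atan (b - Y2 w) - atan (a - Y2 w))| <= 1728 * eps.
Proof.
move=> ab.
have [i1 ->] := expectation_atan P1 mY1 ab.
have [i2 ->] := expectation_atan P2 mY2 ab.
have ie : leb.-integrable `]0%R, +oo[ (EFin \o (fun t => expR (- (2^-1 * t)))).
  by apply: integrable_expRN; rewrite invr_gt0.
have i12 : leb.-integrable `]0%R, +oo[ (EFin \o (fun t =>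
    \int[P1]_w freq_diff a b t (Y1 w) - \int[P2]_w freq_diff a b t (Y2 w))).
  by refine (integrableB _ i1 i2); exact: measurable_itv.
rewrite -RintegralB//; apply: (le_trans (le_normr_Rintegral _ i12)) => //.
have -> : 1728 * eps = \int[leb]_(t in `]0%R, +oo[) (864 * eps * expR (- (2^-1 * t))).
  have e2 : \int[leb]_(t in `]0%R, +oo[) expR (- (2^-1 * t)) = 2.
    by rewrite /Rintegral integral_expRN ?invr_gt0//= invrK.
  by rewrite RintegralZl// e2; ring.
apply: le_Rintegral => //.
- exact: (integrable_norm i12).
- by refine (integrableZl _ (864 * eps) ie); exact: measurable_itv.
- by move=> t; rewrite /= in_itv/= andbT => t0; exact: expectation_freq_diff_close.
Qed.

(** The left endpoint a = -n of [expectation_atanB_close] is sent to -oo: both expectations of atan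
    (a - Y) tend to -pi / 2 and cancel. *)
Lemma expectation_atan_close b :
  `|\int[P1]_w atan (b - Y1 w) - \int[P2]_w atan (b - Y2 w)| <= 1728 * eps.
Proof.
pose z (n : nat) := (\int[P1]_w atan (b - Y1 w) - \int[P1]_w atan (- n%:R - Y1 w)) -
  (\int[P2]_w atan (b - Y2 w) - \int[P2]_w atan (- n%:R - Y2 w)).
have zl : `|z n| @[n --> \oo] -->
    `|(\int[P1]_w atan (b - Y1 w) - - (pi / 2)) - (\int[P2]_w atan (b - Y2 w) - - (pi / 2))|.
  apply: cvg_norm; apply: cvgB; apply: cvgB; try exact: cvg_cst.
    exact: cvg_expectation_atan.
  exact: cvg_expectation_atan.
rewrite [X in `|X|](_ : _ = (\int[P1]_w atan (b - Y1 w) - - (pi / 2)) -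
  (\int[P2]_w atan (b - Y2 w) - - (pi / 2))); last by ring.
rewrite -(cvg_lim _ zl)//; apply: limr_le; first by apply/cvg_ex; eexists; exact: zl.
near=> n.
have nb : - n%:R < b by rewrite ltrNl; near: n; exact: nbhs_infty_gtr.
rewrite /z -!RintegralB//; first exact: expectation_atanB_close.
all: exact: integrable_atanB.
Unshelve. all: by end_near. Qed.

End Cauchy_transform_comparison.

(** * The Cauchy law as a Lebesgue-Stieltjes probability measure *)

Section Cauchy_distribution.
Context {R : realType}.

Definition cauchy_cdf (x : R) : R := 2^-1 + atan x / pi.

Let cauchy_cdf_nd : nondecreasing cauchy_cdf.
Proof.
move=> x y xy; rewrite /cauchy_cdf lerD2l ler_wpM2r ?invr_ge0 ?pi_ge0//.
exact: le_atan.
Qed.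

Let cauchy_cdf_continuous : continuous cauchy_cdf.
Proof.
by move=> x; apply: cvgD; [exact: cvg_cst|apply: cvgMl; exact: continuous_atan].
Qed.

Let cauchy_cdf_rc : right_continuous cauchy_cdf.
Proof. by move=> x; apply: cvg_at_right_filter; exact: cauchy_cdf_continuous. Qed.

HB.instance Definition _ :=
  isCumulative.Build R _ R cauchy_cdf cauchy_cdf_nd cauchy_cdf_rc.

Let cauchy_cdf_y1 : cauchy_cdf @ +oo --> (1 : R).
Proof.
have -> : (1 : R) = 2^-1 + (pi / 2) / pi.
  by have := lt0r_neq0 (@pi_gt0 R); move: (pi : R) => q q0; field.
by apply: cvgD; [exact: cvg_cst|apply: cvgMl; exact: cvgy_atan].
Qed.

Let cauchy_cdf_Ny0 : cauchy_cdf @ -oo --> (0 : R).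
Proof.
(* The symmetry [cauchy_cdf (- x) = 1 - cauchy_cdf x] reduces the limit at -oo to the one at +oo. *)
apply/cvgNy_compNP.
rewrite (_ : _ \o _ = (fun=> 1) - cauchy_cdf); last first.
  apply/funext => x; rewrite !fctE /= /cauchy_cdf atanN.
  by have := lt0r_neq0 (@pi_gt0 R); move: (pi : R) => q q0; field.
have : ((fun=> 1) - cauchy_cdf) x @[x --> +oo] --> (1 - 1 : R).
  by apply: cvgB; [exact: cvg_cst|exact: cauchy_cdf_y1].
by rewrite subrr.
Qed.

HB.instance Definition _ :=
  isCumulativeBounded.Build R 0 1 cauchy_cdf cauchy_cdf_Ny0 cauchy_cdf_y1.

Definition cauchy_prob : probability _ R := lebesgue_stieltjes_measure cauchy_cdf.

Lemma cauchy_prob_itv (r : R) : cauchy_prob `]-oo, r]%classic = (cauchy_cdf r)%:E.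
Proof. exact: (cdf_lebesgue_stieltjes_id cauchy_cdf). Qed.

End Cauchy_distribution.

(** * The smoothing inequality *)

Section smoothing.
Context {R : realType}.
Local Notation Q := (@cauchy_prob R).

(** Real-valued and defined for a bare function, so that it applies directly to the rescaled
    variables Y / s. *)
Definition dist_fun d (T : measurableType d) (P : probability T R) (Y : T -> R) (c : R) : R :=
  fine (P (Y @^-1` `]-oo, c])).

Lemma Rintegral_probability_cst d (T : measurableType d) (P : probability T R) (k : R) :
  \int[P]_w k = k.
Proof. by rewrite /Rintegral integral_cst//= probability_setT mule1. Qed.

Section distribution_function.
Context d (T : measurableType d) (P : probability T R) (Y : T -> R).
Hypothesis mY : measurable_fun setT Y.

Let mpre c : measurable (Y @^-1` `]-oo, c]).
Proof. by rewrite -[X in measurable X]setTI; exact: mY. Qed.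

Lemma dist_fun_nondecreasing : nondecreasing (dist_fun P Y).
Proof.
move=> x y xy; rewrite /dist_fun fine_le ?fin_num_measure//; try exact: mpre.
rewrite le_measure ?inE//; try exact: mpre.
by move=> w /=; rewrite !in_itv/= => /le_trans; apply.
Qed.

Lemma dist_fun_ge0 c : 0 <= dist_fun P Y c.
Proof. exact: fine_ge0. Qed.

Lemma dist_fun_le1 c : dist_fun P Y c <= 1.
Proof.
rewrite -lee_fin /dist_fun fineK; first exact: (probability_le1 _ (mpre c)).
exact: (fin_num_measure _ _ (mpre c)).
Qed.

Lemma measurable_dist_funB x : measurable_fun [set: R] (fun z => dist_fun P Y (x - z)).
Proof.
apply: (@measurableT_comp _ _ _ _ _ _ (dist_fun P Y)).
  exact: nondecreasing_measurable dist_fun_nondecreasing.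
exact: measurable_funB.
Qed.

Lemma integrable_dist_funB x : Q.-integrable setT (EFin \o (fun z => dist_fun P Y (x - z))).
Proof.
apply: (@integrable_bounded _ _ _ _ _ 1) => [|z]; first exact: measurable_dist_funB.
by rewrite ger0_norm ?dist_fun_ge0// dist_fun_le1.
Qed.

(** Both sides are the probability that Y + Z <= x for an independent Cauchy variable Z: integrating
    over Y first gives the left side, over Z first the expectation of [cauchy_cdf (x - Y)]. *)
Lemma cauchy_smoothing x :
  \int[Q]_z dist_fun P Y (x - z) = 2^-1 + (\int[P]_w atan (x - Y w)) / pi.
Proof.
pose A := (fun p : R * T => Y p.2 + p.1) @^-1` `]-oo, x].
have mA : measurable A.
  rewrite -[X in measurable X]setTI; apply: measurable_funD => //.
    exact: (measurableT_comp mY measurable_snd).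
have mf : measurable_fun [set: R * T] (\1_A : R * T -> R) by exact: measurable_indic.
have i1 : Q.-integrable setT (EFin \o (fun=> 1 : R)).
  by apply: (@integrable_bounded _ _ _ _ _ 1) => //= z; rewrite normr1.
have i2 : P.-integrable setT (EFin \o (fun=> 1 : R)).
  by apply: (@integrable_bounded _ _ _ _ _ 1) => //= z; rewrite normr1.
have [|_ e] := Rintegral_Fubini (m1 := Q) (m2 := P) measurableT measurableT mf i1 i2.
  by move=> z w _ _; rewrite mulr1 indicE; case: (_ \in _); rewrite ?normr1 ?normr0.
transitivity (\int[Q]_z \int[P]_w (\1_A (z, w) : R)).
  apply: eq_Rintegral => z _.
  rewrite (_ : (fun w => \1_A (z, w)) = \1_(Y @^-1` `]-oo, x - z])); last first.
    apply/funext => w; rewrite !indicE; congr ((_ : bool)%:R).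
    by apply/idP/idP; rewrite !inE /A/= !in_itv/= lerBrDr.
  by rewrite /Rintegral integral_indic// setIT.
rewrite e.
transitivity (\int[P]_w (cauchy_cdf (x - Y w))).
  apply: eq_Rintegral => w _.
  rewrite (_ : (fun z => \1_A (z, w)) = \1_(`]-oo, x - Y w]%classic)); last first.
    apply/funext => z; rewrite !indicE; congr ((_ : bool)%:R).
    by apply/idP/idP; rewrite !inE /A/= !in_itv/= lerBrDl.
  rewrite /Rintegral integral_indic// setIT.
  by rewrite [X in fine X](cauchy_prob_itv (x - Y w)).
have ia := integrable_atanB P mY x.
rewrite /cauchy_cdf RintegralD//; last 2 first.
- by apply: (@integrable_bounded _ _ _ _ _ `|2^-1|).
- exact: (integrableZr measurableT pi^-1 ia).
by rewrite Rintegral_probability_cst RintegralZr.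
Qed.

End distribution_function.

(* Bounds G + D from below by (m + D) times the indicator of ]-r, r], so that
   the tails of the kernel cost only D, the supremum of |G|. *)
Lemma cauchy_window_le (G : R -> R) (D m eta r c : R) :
  measurable_fun [set: R] (fun z : R => G (c - z)) -> (forall z, `|G z| <= D) -> 0 < r ->
  (forall z, - r < z <= r -> m <= G (c - z)) ->
  \int[Q]_z G (c - z) <= eta ->
  (m + D) * (cauchy_cdf r - cauchy_cdf (- r)) <= eta + D.
Proof.
move=> mG GD r0 mGc Geta.
have iG : Q.-integrable setT (EFin \o (fun z => G (c - z))).
  by apply: (@integrable_bounded _ _ _ _ _ D).
have iK k : Q.-integrable setT (EFin \o (fun=> k : R)).
  by apply: (@integrable_bounded _ _ _ _ _ `|k|).
have i1 k : Q.-integrable setT (EFin \o (\1_(`]-oo, k]%classic) : R -> R)).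
  apply: (@integrable_bounded _ _ _ _ _ 1); first exact: measurable_indic.
  by move=> z; rewrite indicE; case: (_ \in _); rewrite ?normr1 ?normr0.
have e1 k : \int[Q]_z (\1_(`]-oo, k]%classic) z : R) = cauchy_cdf k.
  rewrite /Rintegral integral_indic// setIT.
  by rewrite [X in fine X](cauchy_prob_itv k).
(* The indicator of ]-r, r] is a difference of indicators of half-lines, whose masses are values of
   [cauchy_cdf]. *)
have i11 : Q.-integrable setT (EFin \o
    (fun z => \1_(`]-oo, r]%classic) z - \1_(`]-oo, -r]%classic) z : R)).
  exact: (integrableB measurableT (i1 r) (i1 (- r))).
rewrite -[cauchy_cdf r]e1 -[cauchy_cdf (- r)]e1 -RintegralB// -RintegralZl//.
apply: (@le_trans _ _ (\int[Q]_z (G (c - z) + D))); last first.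
  by rewrite RintegralD// Rintegral_probability_cst lerD2r.
apply: le_Rintegral => //.
- exact: (integrableZl measurableT (m + D) i11).
- exact: (integrableD measurableT iG (iK D)).
move=> z _; rewrite !indicE.
have GD0 : 0 <= G (c - z) + D.
  by have := GD (c - z); rewrite ler_norml => /andP[h _]; rewrite -lerBlDr sub0r.
have [zr|zr] := boolP (z \in `]-oo, r]%classic); last first.
  have [zr'|zr'] := boolP (z \in `]-oo, - r]%classic); last by rewrite subrr mulr0.
  exfalso; move/negP: zr; apply; move: zr'; rewrite !inE/= !in_itv/= => zr'.
  by rewrite (le_trans zr')// (le_trans _ (ltW r0))// oppr_le0 ltW.
have [zr'|zr'] := boolP (z \in `]-oo, - r]%classic); first by rewrite subrr mulr0.
rewrite subr0 mulr1 lerD2r; apply: mGc.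
move: zr; rewrite inE/= in_itv/= => ->; rewrite andbT ltNge.
by apply/negP => zr''; move/negP: zr'; apply; rewrite inE/= in_itv.
Qed.

(* The radius r for which the Cauchy law gives mass 3/4 to ]-r, r]. *)
Definition cauchy_radius : R := tan (3 / 8 * pi).

Lemma atan_cauchy_radius : atan cauchy_radius = 3 / 8 * pi.
Proof.
rewrite /cauchy_radius tanK// in_itv/=; have := @pi_gt0 R.
by move: (pi : R) => q q0; apply/andP; split; lra.
Qed.

Lemma cauchy_radius_gt0 : 0 < cauchy_radius.
Proof.
rewrite ltNge; apply/negP => /le_atan; rewrite atan0 atan_cauchy_radius.
by have := @pi_gt0 R; move: (pi : R) => q q0; lra.
Qed.

Lemma cauchy_radius_mass :
  cauchy_cdf cauchy_radius - cauchy_cdf (- cauchy_radius) = 3 / 4.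
Proof.
rewrite /cauchy_cdf atanN atan_cauchy_radius.
by have := lt0r_neq0 (@pi_gt0 R); move: (pi : R) => q q0; field.
Qed.

Section smoothing_inequality.
Context d1 (T1 : measurableType d1) (P1 : probability T1 R) (Y1 : T1 -> R).
Context d2 (T2 : measurableType d2) (P2 : probability T2 R) (Y2 : T2 -> R).
Hypotheses (mY1 : measurable_fun setT Y1) (mY2 : measurable_fun setT Y2).
Variables eps L : R.
Hypothesis eps0 : 0 <= eps.
Hypothesis cos_close : forall t, 0 < t ->
  `|\int[P1]_w cos (t * Y1 w) - \int[P2]_w cos (t * Y2 w)| <= eps * (t ^+ 2 + t ^+ 4).
Hypothesis sin_close : forall t, 0 < t ->
  `|\int[P1]_w sin (t * Y1 w) - \int[P2]_w sin (t * Y2 w)| <= eps * (t ^+ 2 + t ^+ 4).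
Hypothesis lipschitz : forall x h, 0 <= h -> dist_fun P2 Y2 (x + h) - dist_fun P2 Y2 x <= L * h.

Let F1 := dist_fun P1 Y1.
Let F2 := dist_fun P2 Y2.
Let G x := F1 x - F2 x.

(** The constants 1/2 cancel in the difference, and the factor 1 / pi is estimated by 1. *)
Let smoothed_close x : `|\int[Q]_z G (x - z)| <= 1728 * eps.
Proof.
rewrite /G RintegralB//; try exact: integrable_dist_funB.
rewrite !cauchy_smoothing//.
have -> (u v : R) : 2^-1 + u / pi - (2^-1 + v / pi) = (u - v) / pi by ring.
rewrite normrM [X in _ * X]ger0_norm ?invr_ge0 ?pi_ge0// ler_pdivrMr ?pi_gt0//.
have h := expectation_atan_close mY1 mY2 eps0 cos_close sin_close x.
have pi1 : 1 <= (pi : R) by apply: le_trans (@pi_ge2 R); rewrite ler1n.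
move: (pi : R) pi1 => q q1; apply: (le_trans h).
have : 0 <= 1728 * eps by apply: mulr_ge0; [exact: ler0n|exact: eps0].
by move: (1728 * eps) => e e0; rewrite ler_peMr.
Qed.

Let mG x : measurable_fun [set: R] (fun z => G (x - z)).
Proof. by apply: measurable_funB; exact: measurable_dist_funB. Qed.

(* Centering the window at x + r or x - r and using the monotonicity of F1 bounds
   |F1 - F2| by (4/3) (eta + D/4 + (3/2) r L), where D is the supremum of |F1 - F2|;
   since 4/3 * 1/4 < 1, D can be absorbed. *)
Lemma smoothing_inequality x :
  `|F1 x - F2 x| <= 3456 * eps + 3 * cauchy_radius * L.
Proof.
pose r := cauchy_radius; have r0 : 0 < r := cauchy_radius_gt0.
have G1 z : `|G z| <= 1.
  rewrite ler_norml /G.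
  have := dist_fun_ge0 P1 Y1 z; have := dist_fun_le1 P1 mY1 z.
  have := dist_fun_ge0 P2 Y2 z; have := dist_fun_le1 P2 mY2 z.
  by rewrite -/F1 -/F2 => *; apply/andP; split; lra.
pose D := sup (range (fun z => `|G z|)).
have supG : has_sup (range (fun z => `|G z|)).
  by split; [exists `|G 0|, 0|exists 1 => _ [z _ <-]].
have GD z : `|G z| <= D by apply: sup_upper_bound => //; exists z.
have step z : `|G z| <= (4 / 3) * (1728 * eps + D / 4 + 3 / 2 * r * L).
  have mass := cauchy_radius_mass.
  (* On this window z <= z + r - y < z + 2 r: there [F1] is at least its value at z, and [F2]
     exceeds its value at z by at most 2 r L. *)
  have up : G z <= (4 / 3) * (1728 * eps + D / 4 + 3 / 2 * r * L).
    have := @cauchy_window_le G D (G z - L * (2 * r)) (1728 * eps) r (z + r)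
      (mG _) GD r0 _ _.
    rewrite mass => h.
    suff : (G z - L * (2 * r) + D) * (3 / 4) <= 1728 * eps + D by lra.
    apply: h; last exact: (le_trans (ler_norm _) (smoothed_close _)).
    move=> y /andP[ry yr].
    have h1 : F1 z <= F1 (z + r - y) by apply: dist_fun_nondecreasing => //; lra.
    have h2 : F2 (z + r - y) <= F2 (z + 2 * r) by apply: dist_fun_nondecreasing => //; lra.
    have h3 : F2 (z + 2 * r) - F2 z <= L * (2 * r) by apply: lipschitz; lra.
    rewrite /G; lra.
  (* On this window z - 2 r <= z - r - y < z: there [F1] is at most its value at z, and [F2] lies
     below its value at z by at most 2 r L. *)
  have dn : - G z <= (4 / 3) * (1728 * eps + D / 4 + 3 / 2 * r * L).
    have := @cauchy_window_le (fun y => - G y) D (- G z - L * (2 * r)) (1728 * eps) r (z - r)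
      _ _ r0 _ _.
    rewrite mass => h.
    suff : (- G z - L * (2 * r) + D) * (3 / 4) <= 1728 * eps + D by lra.
    apply: h.
    - by apply: measurable_funN.
    - by move=> y; rewrite normrN.
    - move=> y /andP[ry yr].
      have h1 : F1 (z - r - y) <= F1 z by apply: dist_fun_nondecreasing => //; lra.
      have h2 : F2 (z - 2 * r) <= F2 (z - r - y) by apply: dist_fun_nondecreasing => //; lra.
      have h3 : F2 (z - 2 * r + 2 * r) - F2 (z - 2 * r) <= L * (2 * r) by apply: lipschitz; lra.
      rewrite subrK in h3; rewrite /G; lra.
    apply: (le_trans _ (smoothed_close (z - r))).
    have -> : \int[Q]_y (- G (z - r - y)) = - \int[Q]_y G (z - r - y).
      rewrite -[RHS]mulN1r -RintegralZl//; last first.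
        by apply: (@integrable_bounded _ _ _ Q _ 1 (mG (z - r))) => y; exact: G1.
      by apply: eq_Rintegral => y _; rewrite mulN1r.
    by rewrite -normrN; exact: ler_norm.
  by rewrite ler_norml up andbT lerNl.
(* Since D occurs on the right with weight 1/3, solving for it multiplies the rest by 3/2: this
   gives 3456 = 2 x 1728 and the coefficient 3 of r L. *)
have : D <= (4 / 3) * (1728 * eps + D / 4 + 3 / 2 * r * L).
  by apply: ge_sup; [exists `|G 0|, 0|move=> _ [z _ <-]].
by have := GD x; rewrite -/(G x) -/r => *; lra.
Qed.

End smoothing_inequality.
End smoothing.

(** * Estimates on the complex exponential *)

Section complex_exponential.
Context {R : realType}.
Implicit Types (x y a t : R) (z : R[i]).

Lemma cexp_iM x : cexp ('i * x%:C) = cos x +i* sin x.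
Proof.
rewrite -complexiE /cexp /=.
by rewrite !(mul0r, mul1r, mulr0, sub0r, subr0, add0r, addr0, oppr0, expR0).
Qed.

Lemma Re_natM (n : nat) z : complex.Re (n%:R * z) = n%:R * complex.Re z.
Proof.
have -> : (n%:R : R[i]) = (n%:R)%:C by rewrite rmorph_nat.
by case: z => u v /=; rewrite mul0r subr0.
Qed.

Lemma Im_natM (n : nat) z : complex.Im (n%:R * z) = n%:R * complex.Im z.
Proof.
have -> : (n%:R : R[i]) = (n%:R)%:C by rewrite rmorph_nat.
by case: z => u v /=; rewrite mul0r addr0.
Qed.

Lemma Re_natVM (n : nat) z : complex.Re (n%:R^-1 * z) = n%:R^-1 * complex.Re z.
Proof.
have -> : (n%:R^-1 : R[i]) = (n%:R^-1)%:C by rewrite fmorphV rmorph_nat.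
by case: z => u v /=; rewrite mul0r subr0.
Qed.

Lemma Im_natVM (n : nat) z : complex.Im (n%:R^-1 * z) = n%:R^-1 * complex.Im z.
Proof.
have -> : (n%:R^-1 : R[i]) = (n%:R^-1)%:C by rewrite fmorphV rmorph_nat.
by case: z => u v /=; rewrite mul0r addr0.
Qed.

Lemma sin_norm_le x : `|sin x| <= `|x|.
Proof. by have := sin_lipschitz 0 x; rewrite sin0 !subr0. Qed.

Lemma cos_sub1_le x : `|cos x - 1| <= x ^+ 2.
Proof.
have -> : cos x - 1 = - (2 * sin (x / 2) ^+ 2).
  have {1}-> : x = (x / 2) *+ 2 by rewrite -mulr_natr; field.
  by rewrite cos_mulr2n sin2cos2 mulr2n; ring.
rewrite normrN normrM ger0_norm// normrX.
have h : `|sin (x / 2)| ^+ 2 <= `|x / 2| ^+ 2.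
  by rewrite lerXn2r ?nnegrE// sin_norm_le.
rewrite (le_trans (ler_wpM2l _ h))// real_normK ?num_real//.
have -> : 2 * (x / 2) ^+ 2 = x ^+ 2 / 2 by field.
by have := sqr_ge0 x; lra.
Qed.

(** The mean value theorem, with |cos c - 1| <= |c|. Order two, rather than three, matches the
    integrability of u^2 against the Lévy measure. *)
Lemma sin_subid_le x : `|sin x - x| <= x ^+ 2.
Proof.
wlog x0 : x / 0 < x => [H|].
  case: (ltgtP 0 x) => [|x0|<-]; first exact: H.
    have := H (- x); rewrite oppr_gt0 sinN sqrrN -opprD normrN; exact.
  by rewrite sin0 subrr normr0 expr0n.
have dF (y : R) : is_derive y 1 (@sin R - id) (cos y - 1) by apply: is_derive_eq.
have cF : {within `[0, x], continuous (@sin R - id)}.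
  apply: continuous_subspaceT => y.
  by apply/differentiable_continuous/derivable1_diffP; apply: ex_derive.
have [c] := MVT x0 (fun y _ => dF y) cF.
rewrite in_itv/= => /andP[c0 cx]; rewrite !fctE /= sin0 !subr0 => ->.
rewrite normrM [`|x|]gtr0_norm// expr2 ler_wpM2r ?(ltW x0)//.
have := cos_lipschitz 0 c; rewrite cos0 subr0 => h; apply: (le_trans h).
by rewrite gtr0_norm// ltW.
Qed.

(** The larger exponential factors out and is at most 1; the remaining factor is handled by 1 + x <=
    e^x. *)
Lemma expR_lipschitz_le0 a b : a <= 0 -> b <= 0 -> `|expR a - expR b| <= `|a - b|.
Proof.
wlog ab : a b / a <= b => [H a0 b0|a0 b0].
  case/orP: (le_total a b) => h; first exact: H.
  by rewrite distrC [leRHS]distrC; exact: H.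
rewrite distrC [leRHS]distrC !ger0_norm ?subr_ge0 ?ler_expR//.
have -> : expR a = expR b * expR (a - b) by rewrite -expRD addrC subrK.
rewrite -[X in X - _ <= _]mulr1 -mulrBr.
have h1 : 1 - expR (a - b) <= b - a by have := expR_ge1Dx (a - b); lra.
have h2 : 0 <= 1 - expR (a - b) by rewrite subr_ge0 -expR0 ler_expR subr_le0.
by apply: le_trans h1; rewrite ler_piMl// -expR0 ler_expR.
Qed.

(** From 1 - a <= e^(-a) follows e^a <= 1 / (1 - a), and 1 / (1 - a) - 1 - a = a^2 / (1 - a). *)
Lemma expR_le0_taylor a : a <= 0 -> `|expR a - 1 - a| <= a ^+ 2.
Proof.
move=> a0; rewrite ger0_norm; last by have := expR_ge1Dx a; lra.
have h : expR a <= (1 - a)^-1.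
  rewrite -[expR a]invrK -expRN lef_pV2 ?posrE ?expR_gt0//; last by lra.
  exact: expR_ge1Dx.
have : (1 - a)^-1 - 1 - a = a ^+ 2 / (1 - a) by field; rewrite gt_eqF//; lra.
have : a ^+ 2 / (1 - a) <= a ^+ 2.
  by rewrite ler_pdivrMr; [rewrite ler_peMr ?sqr_ge0//; lra|lra].
by lra.
Qed.

(** Together with [Im_cexp_taylor], this is the second-order Taylor estimate of e^z at z = a + i y
    in the left half-plane, component by component. *)
Lemma Re_cexp_taylor a y : a <= 0 ->
  `|expR a * cos y - 1 - a| <= 2 * (a ^+ 2 + y ^+ 2).
Proof.
move=> a0.
have -> : expR a * cos y - 1 - a = (expR a - 1 - a) + expR a * (cos y - 1) by ring.
rewrite (le_trans (ler_normD _ _))//.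
have h1 := expR_le0_taylor a0.
have h2 : `|expR a * (cos y - 1)| <= y ^+ 2.
  rewrite normrM ger0_norm ?expR_ge0//.
  apply: (le_trans _ (cos_sub1_le y)).
  by rewrite ler_piMl// -expR0 ler_expR.
by have := sqr_ge0 a; have := sqr_ge0 y; lra.
Qed.

Lemma Im_cexp_taylor a y : a <= 0 ->
  `|expR a * sin y - y| <= 2 * (a ^+ 2 + y ^+ 2).
Proof.
move=> a0.
have -> : expR a * sin y - y = (expR a - 1) * sin y + (sin y - y) by ring.
rewrite (le_trans (ler_normD _ _))//.
have h1 := sin_subid_le y.
have h2 : `|(expR a - 1) * sin y| <= `|a| * `|y|.
  rewrite normrM ler_pM// ?sin_norm_le//.
  by have := expR_lipschitz_le0 a0 (lexx 0); rewrite expR0 subr0.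
(* This square bounds the mixed term: 2 |a| |y| <= a^2 + y^2. *)
have h3 : 0 <= (`|a| - `|y|) ^+ 2 by exact: sqr_ge0.
have := sqr_ge0 a; have := sqr_ge0 y.
rewrite -(@real_normK _ a) ?num_real// -(@real_normK _ y) ?num_real// in h1 *.
by move: h1 h2 h3; set A := `|a|; set B := `|y|; nra.
Qed.

(** The modulus is changed first and the argument second; the increments carry the factors |cos x|
    and e^b, both at most 1. *)
Lemma Re_cexp_lipschitz a b x y : a <= 0 -> b <= 0 ->
  `|expR a * cos x - expR b * cos y| <= `|a - b| + `|x - y|.
Proof.
move=> a0 b0.
have -> : expR a * cos x - expR b * cos y =
  (expR a - expR b) * cos x + expR b * (cos x - cos y) by ring.
rewrite (le_trans (ler_normD _ _))// !normrM; apply: lerD.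
  apply: (le_trans _ (expR_lipschitz_le0 a0 b0)).
  by rewrite ler_piMr// cos_max.
apply: (le_trans _ (cos_lipschitz y x)).
by rewrite ler_piMl// ger0_norm ?expR_ge0// -expR0 ler_expR.
Qed.

Lemma Im_cexp_lipschitz a b x y : a <= 0 -> b <= 0 ->
  `|expR a * sin x - expR b * sin y| <= `|a - b| + `|x - y|.
Proof.
move=> a0 b0.
have -> : expR a * sin x - expR b * sin y =
  (expR a - expR b) * sin x + expR b * (sin x - sin y) by ring.
rewrite (le_trans (ler_normD _ _))// !normrM; apply: lerD.
  apply: (le_trans _ (expR_lipschitz_le0 a0 b0)).
  by rewrite ler_piMr// sin_max.
apply: (le_trans _ (sin_lipschitz y x)).
by rewrite ler_piMl// ger0_norm ?expR_ge0// -expR0 ler_expR.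
Qed.

(** With w = z / n and v = n (e^w - 1), the difference v - z is n (e^w - 1 - w), of order |z|^2 / n
    by the Taylor bounds; the Lipschitz bounds carry this over to e^v - e^z. The 4 adds the
    constants 2 of the real and imaginary parts. *)
Lemma accompanying_close (n : nat) z : (0 < n)%N -> complex.Re z <= 0 ->
  `|complex.Re (cexp (n%:R * (cexp (n%:R^-1 * z) - 1))) - complex.Re (cexp z)| <=
    4 * n%:R^-1 * (complex.Re z ^+ 2 + complex.Im z ^+ 2) /\
  `|complex.Im (cexp (n%:R * (cexp (n%:R^-1 * z) - 1))) - complex.Im (cexp z)| <=
    4 * n%:R^-1 * (complex.Re z ^+ 2 + complex.Im z ^+ 2).
Proof.
move=> n0 z0; pose N : R := n%:R; have N0 : 0 < N by rewrite ltr0n.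
set w := n%:R^-1 * z; set v := n%:R * _.
have wR : complex.Re w = N^-1 * complex.Re z by rewrite Re_natVM.
have wI : complex.Im w = N^-1 * complex.Im z by rewrite Im_natVM.
have zR : complex.Re z = N * complex.Re w by rewrite wR mulrA mulfV ?mul1r ?gt_eqF.
have zI : complex.Im z = N * complex.Im w by rewrite wI mulrA mulfV ?mul1r ?gt_eqF.
have vR : complex.Re v = N * (expR (complex.Re w) * cos (complex.Im w) - 1).
  by rewrite /v Re_natM.
have vI : complex.Im v = N * (expR (complex.Re w) * sin (complex.Im w)).
  by rewrite /v Im_natM /= subr0.
have w0 : complex.Re w <= 0 by rewrite wR pmulr_rle0// invr_gt0.
(* Since |e^w| <= 1, [v] stays in the left half-plane, as the Lipschitz bounds require. *)
have v0 : complex.Re v <= 0.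
  rewrite vR pmulr_rle0// subr_le0.
  rewrite (le_trans (ler_norm _))// normrM ger0_norm ?expR_ge0// mulr_ile1 ?expR_ge0//.
    by rewrite -expR0 ler_expR.
  exact: cos_max.
have dR : `|complex.Re v - complex.Re z| <= 2 * N^-1 * (complex.Re z ^+ 2 + complex.Im z ^+ 2).
  have -> : complex.Re v - complex.Re z =
      N * (expR (complex.Re w) * cos (complex.Im w) - 1 - complex.Re w).
    by rewrite vR zR; ring.
  rewrite normrM gtr0_norm//.
  apply: (le_trans (ler_wpM2l (ltW N0) (Re_cexp_taylor _ w0))).
  by rewrite wR wI le_eqVlt; apply/orP; left; apply/eqP; field; rewrite gt_eqF.
have dI : `|complex.Im v - complex.Im z| <= 2 * N^-1 * (complex.Re z ^+ 2 + complex.Im z ^+ 2).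
  have -> : complex.Im v - complex.Im z =
      N * (expR (complex.Re w) * sin (complex.Im w) - complex.Im w).
    by rewrite vI zI; ring.
  rewrite normrM gtr0_norm//.
  apply: (le_trans (ler_wpM2l (ltW N0) (Im_cexp_taylor _ w0))).
  by rewrite wR wI le_eqVlt; apply/orP; left; apply/eqP; field; rewrite gt_eqF.
have sum : `|complex.Re v - complex.Re z| + `|complex.Im v - complex.Im z| <=
    4 * N^-1 * (complex.Re z ^+ 2 + complex.Im z ^+ 2) by lra.
split; apply: (le_trans _ sum).
  exact: Re_cexp_lipschitz.
exact: Im_cexp_lipschitz.
Qed.

End complex_exponential.

(** * The Lévy exponent *)

Section characteristic_functions.
Context {R : realType}.

Lemma normr_Rintegral_le d (T : measurableType d) (mu : {measure set T -> \bar R})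
    (f g : T -> R) : measurable_fun setT f -> mu.-integrable setT (EFin \o g) ->
  (forall x, `|f x| <= g x) -> `|\int[mu]_x f x| <= \int[mu]_x g x.
Proof.
move=> mf ig fg.
have if_ : mu.-integrable setT (EFin \o f).
  apply: (@le_integrable _ _ _ _ _ _ _ (EFin \o g)) => //.
    exact/measurable_EFinP.
  by move=> x _ /=; rewrite lee_fin (le_trans (fg x))// ler_norm.
apply: (le_trans (le_normr_Rintegral _ if_)) => //.
by apply: le_Rintegral => //; exact: (integrable_norm if_).
Qed.

Lemma Re_char_fun d (T : measurableType d) (P : probability T R) (X : {RV P >-> R}) t :
  complex.Re (char_fun X t) = \int[P]_w cos (t * X w).
Proof.
transitivity (\int[P]_w complex.Re (cexp ('i * (t * X w)%:C))); first by [].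
by apply: eq_Rintegral => w _; rewrite cexp_iM.
Qed.

Lemma Im_char_fun d (T : measurableType d) (P : probability T R) (X : {RV P >-> R}) t :
  complex.Im (char_fun X t) = \int[P]_w sin (t * X w).
Proof.
transitivity (\int[P]_w complex.Im (cexp ('i * (t * X w)%:C))); first by [].
by apply: eq_Rintegral => w _; rewrite cexp_iM.
Qed.

Section exponent_bounds.
Variables (b : R) (nu : {measure set (measurableTypeR R) -> \bar R}) (S : R).
Hypothesis nuS : (\int[nu]_u (u ^+ 2)%:E)%E = S%:E.

Let trunc (u : R) : R := ((`|u| <= 1)%R : nat)%:R.

Let integrand t u : cexp ('i * (t * u)%:C) - 1 - 'i * (t * u)%:C * ((`|u| <= 1)%R : nat)%:R
  = (cos (t * u) - 1) +i* (sin (t * u) - t * u * trunc u).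
Proof.
rewrite cexp_iM -complexiE /trunc; case: (`|u| <= 1); apply/eqP; rewrite eq_complex /=;
  apply/andP; split; apply/eqP; ring.
Qed.

Lemma Re_levy_exponent t :
  complex.Re (levy_exponent b nu t) = \int[nu]_u (cos (t * u) - 1).
Proof.
rewrite /levy_exponent -complexiE /= !(mul0r, mul1r, mulr0, subr0, oppr0, add0r).
by apply: eq_Rintegral => u _; rewrite complexiE integrand.
Qed.

Lemma Im_levy_exponent t :
  complex.Im (levy_exponent b nu t) =
  t * b + \int[nu]_u (sin (t * u) - t * u * trunc u).
Proof.
rewrite /levy_exponent -complexiE /= !(mul0r, mul1r, mulr0, subr0, add0r).
by congr (_ + _); apply: eq_Rintegral => u _; rewrite complexiE integrand.
Qed.

Let integrable_sqr : nu.-integrable setT (EFin \o (fun u : R => u ^+ 2)).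
Proof.
apply/integrableP; split; first exact/measurable_EFinP/measurable_funX.
rewrite [X in (X < _)%E](_ : _ = S%:E) ?ltry// -nuS; apply: eq_integral => u _.
by rewrite /= ger0_norm ?sqr_ge0.
Qed.

Let RnuS : \int[nu]_u (u ^+ 2) = S.
Proof. by rewrite /Rintegral nuS. Qed.

Lemma levy_variance_ge0 : 0 <= S.
Proof. by rewrite -RnuS; apply: Rintegral_ge0 => u _; exact: sqr_ge0. Qed.

(** This places the exponent in the half-plane where the estimates on [cexp] hold. *)
Lemma Re_levy_exponent_le0 t : complex.Re (levy_exponent b nu t) <= 0.
Proof.
rewrite Re_levy_exponent -oppr_ge0.
have mc : measurable_fun [set: R] (fun u : R => cos (t * u) - 1).
  apply: measurable_funB => //.
  by apply: (measurableT_comp measurable_cos); exact: measurable_funM.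
have ic : nu.-integrable setT (EFin \o (fun u : R => cos (t * u) - 1)).
  apply: (@le_integrable _ _ _ nu _ measurableT _ (EFin \o (fun u : R => t ^+ 2 * u ^+ 2))).
  - exact/measurable_EFinP.
  - move=> u _ /=; rewrite lee_fin -exprMn.
    by rewrite [leRHS]ger0_norm ?sqr_ge0// cos_sub1_le.
  - exact: (integrableZl measurableT (t ^+ 2) integrable_sqr).
rewrite -[X in 0 <= X]mulN1r -RintegralZl//; apply: Rintegral_ge0 => u _.
by rewrite mulN1r oppr_ge0 subr_le0 cos_le1.
Qed.

Lemma normr_Re_levy_exponent t : `|complex.Re (levy_exponent b nu t)| <= t ^+ 2 * S.
Proof.
rewrite Re_levy_exponent -RnuS -RintegralZl//.
apply: normr_Rintegral_le.
- apply: measurable_funB => //.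
  by apply: (measurableT_comp measurable_cos); exact: measurable_funM.
- exact: (integrableZl measurableT (t ^+ 2) integrable_sqr).
- by move=> u; rewrite -exprMn cos_sub1_le.
Qed.

(** The bound adds up two regimes: for |u| <= 1 the compensated integrand is at most (t u)^2, and
    for |u| > 1 the sine alone is at most |t u| <= |t| u^2. *)
Lemma normr_Im_levy_exponentB t :
  `|complex.Im (levy_exponent b nu t) - t * b| <= (t ^+ 2 + `|t|) * S.
Proof.
rewrite Im_levy_exponent [_ + _ - _]addrC addKr -RnuS -RintegralZl//.
have mtrunc : measurable_fun [set: R] trunc.
  have -> : trunc = \1_(`[-1, 1]%classic).
    apply/funext => u; rewrite indicE /trunc; congr ((nat_of_bool _)%:R).
    by rewrite ler_norml; apply/idP/idP; rewrite inE/= in_itv.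
  exact: measurable_indic.
apply: normr_Rintegral_le.
- apply: measurable_funB.
    by apply: (measurableT_comp measurable_sin); exact: measurable_funM.
  by apply: measurable_funM => //; exact: measurable_funM.
- exact: (integrableZl measurableT (t ^+ 2 + `|t|) integrable_sqr).
- move=> u; rewrite /trunc mulrDl -exprMn; have [u1|u1] := boolP (`|u| <= 1).
    by rewrite mulr1 (le_trans (sin_subid_le _))// lerDl mulr_ge0 ?sqr_ge0.
  rewrite mulr0 subr0 (le_trans (sin_norm_le _))// normrM.
  apply: (@le_trans _ _ (`|t| * u ^+ 2)); last by rewrite lerDr sqr_ge0.
  rewrite ler_wpM2l// -real_normK ?num_real// expr2 ler_peMr//.
  by rewrite ltW// ltNge.
Qed.

(** Each component is at most (|b| + S) (t + t^2); the 4 comes from adding two squares and from (t +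
    t^2)^2 <= 2 (t^2 + t^4). *)
Lemma levy_exponent_sqr_le t : 0 <= t ->
  complex.Re (levy_exponent b nu t) ^+ 2 + complex.Im (levy_exponent b nu t) ^+ 2 <=
  4 * (`|b| + S) ^+ 2 * (t ^+ 2 + t ^+ 4).
Proof.
move=> t0; have S0 := levy_variance_ge0; have b0 : 0 <= `|b| by [].
set M := `|b| + S; have M0 : 0 <= M by rewrite addr_ge0.
have SM : S <= M by rewrite lerDr.
have h1 : `|complex.Re (levy_exponent b nu t)| <= M * (t + t ^+ 2).
  apply: (le_trans (normr_Re_levy_exponent t)); rewrite mulrC.
  by rewrite ler_pM ?sqr_ge0// lerDr.
have h2 : `|complex.Im (levy_exponent b nu t)| <= M * (t + t ^+ 2).
  rewrite -[complex.Im _](subrK (t * b)) (le_trans (ler_normD _ _))//.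
  have := normr_Im_levy_exponentB t; rewrite [`|t|]ger0_norm// => h.
  apply: (le_trans (lerD h (lexx _))); rewrite normrM [`|t|]ger0_norm// /M.
  have : 0 <= t ^+ 2 * `|b| by rewrite mulr_ge0 ?sqr_ge0.
  by move: (t ^+ 2) (`|b|) => *; nra.
have sq x : `|x| <= M * (t + t ^+ 2) -> x ^+ 2 <= M ^+ 2 * (t + t ^+ 2) ^+ 2.
  move=> h; rewrite -exprMn -real_normK ?num_real//.
  by rewrite lerXn2r ?nnegrE// mulr_ge0// addr_ge0 ?sqr_ge0.
apply: (le_trans (lerD (sq _ h1) (sq _ h2))).
have h : (t + t ^+ 2) ^+ 2 <= 2 * (t ^+ 2 + t ^+ 4).
  have := sqr_ge0 (t - t ^+ 2).
  have -> : (t - t ^+ 2) ^+ 2 = t ^+ 2 - 2 * t ^+ 3 + t ^+ 4 by ring.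
  have -> : (t + t ^+ 2) ^+ 2 = t ^+ 2 + 2 * t ^+ 3 + t ^+ 4 by ring.
  by lra.
have := ler_wpM2l (sqr_ge0 M) h; lra.
Qed.

End exponent_bounds.

(** * Bounded densities and rescaling *)

Lemma bounded_density_lipschitz d (T : measurableType d) (P : probability T R)
    (X : {RV P >-> R}) : has_bounded_density X ->
  exists2 L : R, 0 <= L &
    forall x h, 0 <= h -> dist_fun P X (x + h) - dist_fun P X x <= L * h.
Proof.
move=> [f [mf f0 [M fM] Xf]].
have M0 : 0 <= M := le_trans (f0 0) (fM 0).
exists M => // x h h0.
have mI (i : interval R) : measurable (X @^-1` [set` i]).
  by rewrite -[X in measurable X]setTI; exact: measurable_funPT.
have -> : dist_fun P X (x + h) = dist_fun P X x + fine (P (X @^-1` `]x, x + h])).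
  rewrite /dist_fun -fineD ?fin_num_measure//; try exact: mI.
  rewrite -measureU//; try exact: mI.
    congr (fine (P _)); rewrite -preimage_setU; congr (_ @^-1` _).
    by apply: itv_bndbnd_setU; rewrite // bnd_simp lerDl.
  rewrite -preimage_setI -subset0 => w /=; rewrite !in_itv/= => -[wx /andP[xw _]].
  by rewrite ltNge wx in xw.
rewrite [X in X <= _]addrC addKr -lee_fin fineK ?fin_num_measure//.
have := Xf _ (measurable_itv `]x, x + h]); rewrite /distribution/pushforward => ->.
have e : (\int[@lebesgue_measure R]_(y in `]x, (x + h)%R]) (cst M%:E) y)%E = (M * h)%:E.
  rewrite integral_cst//= lebesgue_measure_itv/= lte_fin.
  (* The length of ]x, x + h] is h if x < x + h and 0 otherwise; the latter case forces h = 0. *)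
  case: ifPn => [_|]; first by rewrite -EFinB -EFinM addrAC subrr add0r.
  by rewrite ltrDl -leNgt => h0'; rewrite (_ : h = 0) ?mulr0 ?mule0//; lra.
rewrite -e; apply: ge0_le_integral => //.
- by move=> y _; rewrite lee_fin.
- by apply/measurable_EFinP; exact: measurable_funTS.
- by move=> y _; rewrite lee_fin.
Qed.

(** [smoothing_inequality] is applied to Y1 / s and Y2 / s: frequencies t become t / s, which costs
    at most a factor s^(-4) as s <= 1, while the Lipschitz constant L becomes L s. *)
Lemma scaled_smoothing d1 (T1 : measurableType d1) (P1 : probability T1 R) (Y1 : T1 -> R)
    d2 (T2 : measurableType d2) (P2 : probability T2 R) (Y2 : T2 -> R) (eps L s : R) :
  measurable_fun setT Y1 -> measurable_fun setT Y2 -> 0 <= eps -> 0 < s <= 1 ->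
  (forall t, 0 < t -> `|\int[P1]_w cos (t * Y1 w) - \int[P2]_w cos (t * Y2 w)|
     <= eps * (t ^+ 2 + t ^+ 4)) ->
  (forall t, 0 < t -> `|\int[P1]_w sin (t * Y1 w) - \int[P2]_w sin (t * Y2 w)|
     <= eps * (t ^+ 2 + t ^+ 4)) ->
  (forall x h, 0 <= h -> dist_fun P2 Y2 (x + h) - dist_fun P2 Y2 x <= L * h) ->
  forall x, `|dist_fun P1 Y1 x - dist_fun P2 Y2 x| <=
    3456 * (eps / s ^+ 4) + 3 * cauchy_radius * (L * s).
Proof.
move=> mY1 mY2 eps0 /andP[s0 s1] hcos hsin lip x.
have scaled d (T : measurableType d) (P : probability T R) (Y : T -> R) c :
    dist_fun P (fun w => Y w / s) c = dist_fun P Y (c * s).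
  rewrite /dist_fun; congr (fine (P _)); apply/seteqP.
  by split => w /=; rewrite !in_itv/= ler_pdivrMr.
have scale t u : t * (u / s) = (t / s) * u by ring.
have bound t : 0 < t -> eps * ((t / s) ^+ 2 + (t / s) ^+ 4) <= eps / s ^+ 4 * (t ^+ 2 + t ^+ 4).
  move=> t0; rewrite -mulrA ler_wpM2l//.
  have -> : (t / s) ^+ 2 + (t / s) ^+ 4 = (s ^+ 4)^-1 * (s ^+ 2 * t ^+ 2 + t ^+ 4).
    by field; rewrite gt_eqF.
  rewrite ler_wpM2l ?invr_ge0 ?exprn_ge0 ?(ltW s0)// lerD2r.
  by rewrite ler_piMl ?sqr_ge0// exprn_ile1// ltW.
have := @smoothing_inequality R _ _ P1 (fun w => Y1 w / s) _ _ P2 (fun w => Y2 w / s)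
  _ _ (eps / s ^+ 4) (L * s) _ _ _ _ (x / s).
rewrite !scaled mulfVK ?gt_eqF//; apply.
- exact: measurable_funM.
- exact: measurable_funM.
- by rewrite divr_ge0 ?exprn_ge0 ?(ltW s0).
- move=> t t0; apply: le_trans (bound t t0).
  under eq_Rintegral do rewrite scale; under [X in _ - X]eq_Rintegral do rewrite scale.
  by apply: hcos; rewrite divr_gt0.
- move=> t t0; apply: le_trans (bound t t0).
  under eq_Rintegral do rewrite scale; under [X in _ - X]eq_Rintegral do rewrite scale.
  by apply: hsin; rewrite divr_gt0.
- move=> y h h0; rewrite !scaled mulrDl -mulrA [s * h]mulrC.
  by apply: lip; rewrite mulr_ge0// ltW.
Qed.

End characteristic_functions.

(** * Rate of convergence *)

Section accompanying_laws.
Context {R : realType} d (T : measurableType d) (P : probability T R).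
Variables (X : {RV P >-> R}) (b : R) (nu : {measure set (measurableTypeR R) -> \bar R}).
Variable S : R.
Hypothesis XID : is_ID X b nu.
Hypothesis nuS : (\int[nu]_u (u ^+ 2)%:E)%E = S%:E.

(** The 16 is the product of the 4 of [accompanying_close] and the 4 of [levy_exponent_sqr_le]. *)
Lemma accompanying_cf_close (n : nat) d' (T' : measurableType d') (P' : probability T' R)
    (Y : {RV P' >-> R}) : (0 < n)%N ->
  (forall t, char_fun Y t = cexp (n%:R * (ID_cf_root b nu n t - 1))) ->
  forall t, 0 < t ->
  `|\int[P']_w cos (t * Y w) - \int[P]_w cos (t * X w)|
    <= 16 * (`|b| + S) ^+ 2 * n%:R^-1 * (t ^+ 2 + t ^+ 4) /\
  `|\int[P']_w sin (t * Y w) - \int[P]_w sin (t * X w)|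
    <= 16 * (`|b| + S) ^+ 2 * n%:R^-1 * (t ^+ 2 + t ^+ 4).
Proof.
move=> n0 Ycf t t0; have [_ Xcf] := XID.
rewrite -!Re_char_fun -!Im_char_fun Ycf Xcf /ID_cf_root.
have [hR hI] := accompanying_close n0 (Re_levy_exponent_le0 b nuS t).
have h := levy_exponent_sqr_le b nuS (ltW t0).
have N0 : 0 <= 4 * (n%:R^-1 : R) by rewrite mulr_ge0 ?invr_ge0.
have := ler_wpM2l N0 h.
rewrite (_ : _ * (4 * _ * _) = 16 * (`|b| + S) ^+ 2 * n%:R^-1 * (t ^+ 2 + t ^+ 4)); last by ring.
by move=> h'; split; [exact: le_trans hR h'|exact: le_trans hI h'].
Qed.

Lemma accompanying_rate (L : R) : 0 <= L ->
  (forall x h, 0 <= h -> dist_fun P X (x + h) - dist_fun P X x <= L * h) ->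
  exists2 K : R, 0 < K &
    forall (n : nat) d' (T' : measurableType d') (P' : probability T' R)
      (Y : {RV P' >-> R}), (0 < n)%N ->
    (forall t, char_fun Y t = cexp (n%:R * (ID_cf_root b nu n t - 1))) ->
    forall x, `|dist_fun P' Y x - dist_fun P X x| <= K * n%:R^-1 `^ 5^-1.
Proof.
move=> L0 lip.
pose A := 16 * (`|b| + S) ^+ 2.
have A0 : 0 <= A by rewrite mulr_ge0 ?sqr_ge0.
have r0 := @cauchy_radius_gt0 R.
(* The added 1 keeps the constant positive even when [A] and [L] vanish. *)
exists (3456 * A + 3 * cauchy_radius * L + 1).
  have h1 : 0 <= 3456 * A by apply: mulr_ge0; [exact: ler0n|].
  have h2 : 0 <= 3 * cauchy_radius * L.
    by apply: mulr_ge0 => //; apply: mulr_ge0 => //; exact: ltW.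
  by move: (3456 * A) h1 => B B0; lra.
move=> n d' T' P' Y n0 Ycf x.
set s := _ `^ _.
have N0 : 0 < (n%:R^-1 : R) by rewrite invr_gt0 ltr0n.
have N1 : (n%:R^-1 : R) <= 1 by rewrite invf_le1 ?ltr0n// ler1n.
have s0 : 0 < s by exact: powR_gt0.
have s5 : s ^+ 5 = n%:R^-1.
  by rewrite -powR_mulrn ?powR_ge0// -powRrM mulVf// powRr1// ltW.
have s1 : s <= 1.
  by rewrite leNgt; apply/negP => s1; move: N1; rewrite -s5 leNgt exprn_egt1.
have close := accompanying_cf_close n0 Ycf.
have e0 : 0 <= A * n%:R^-1 by rewrite mulr_ge0// ltW.
have s01 : 0 < s <= 1 by rewrite s0 s1.
have := scaled_smoothing (measurable_funPT Y) (measurable_funPT X) e0 s01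
  (fun t t0 => (close t t0).1) (fun t t0 => (close t t0).2) lip x.
(* Since 1 / n = s^5, both terms of the scaled bound are multiples of s. *)
have -> : A * n%:R^-1 / s ^+ 4 = A * s.
  by rewrite -s5; field; rewrite gt_eqF.
move: (3456 : R) => c h; apply: (le_trans h).
have -> : (c * A + 3 * cauchy_radius * L + 1) * s =
  c * (A * s) + 3 * cauchy_radius * (L * s) + s by ring.
by rewrite lerDl ltW.
Qed.

Lemma levy_variance_gt0 : has_bounded_density X -> 0 < S.
Proof.
move=> /bounded_density_lipschitz[L L0 lip].
rewrite lt_neqAle (levy_variance_ge0 nuS) andbT; apply/eqP => S0.
have [_ Xcf] := XID.
have ReS t : complex.Re (levy_exponent b nu t) = 0.
  apply/eqP; rewrite -normr_le0 (le_trans (normr_Re_levy_exponent b nuS t))//.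
  by rewrite -S0 mulr0.
have ImS t : complex.Im (levy_exponent b nu t) = t * b.
  apply/eqP; rewrite -subr_eq0 -normr_le0.
  by rewrite (le_trans (normr_Im_levy_exponentB b nuS t))// -S0 mulr0.
have r0 := @cauchy_radius_gt0 R.
set K := 3 * cauchy_radius * L.
have K0 : 0 <= K by apply: mulr_ge0 => //; apply: mulr_ge0 => //; exact: ltW.
(* When S = 0 this constant variable has the characteristic function of [X], so smoothing applies
   with eps = 0. *)
pose c (w : T) : R := b.
have mc : measurable_fun setT c by exact: measurable_cst.
have cc t : \int[P]_w cos (t * c w) - \int[P]_w cos (t * X w) = 0.
  rewrite -Re_char_fun Xcf.
  rewrite [complex.Re _](_ : _ = expR (complex.Re (levy_exponent b nu t)) *
    cos (complex.Im (levy_exponent b nu t)))//.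
  rewrite ReS ImS expR0 mul1r [X in X - _](Rintegral_probability_cst P (cos (t * b))).
  by rewrite subrr.
have cs t : \int[P]_w sin (t * c w) - \int[P]_w sin (t * X w) = 0.
  rewrite -Im_char_fun Xcf.
  rewrite [complex.Im _](_ : _ = expR (complex.Re (levy_exponent b nu t)) *
    sin (complex.Im (levy_exponent b nu t)))//.
  rewrite ReS ImS expR0 mul1r [X in X - _](Rintegral_probability_cst P (sin (t * b))).
  by rewrite subrr.
have close s x : 0 < s <= 1 -> `|dist_fun P c x - dist_fun P X x| <= K * s.
  move=> s01.
  have := scaled_smoothing mc (measurable_funPT X) (lexx 0) s01 _ _ lip x.
  rewrite mul0r mulr0 add0r mulrA; apply.
    by move=> t _; rewrite cc normr0 mul0r.
  by move=> t _; rewrite cs normr0 mul0r.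
have db : dist_fun P c b = 1.
  rewrite /dist_fun (_ : _ @^-1` _ = setT) ?probability_setT//.
  by apply/seteqP; split => w //= _; rewrite in_itv/= lexx.
have dbh h : 0 < h -> dist_fun P c (b - h) = 0.
  move=> h0; rewrite /dist_fun (_ : _ @^-1` _ = set0) ?measure0//.
  by rewrite -subset0 => w /=; rewrite in_itv/= /c lerBrDr gerDl leNgt h0.
(* From b - h to b the distribution function of [c] jumps by 1 and that of [X] grows by at most L h,
   while at both points they differ by at most K h. Hence 1 <= (2 K + L) h, which this choice of h
   keeps at most 1/2. *)
pose h := (2 * (2 * K + L + 1))^-1.
have D0 : 0 < 2 * K + L + 1 by lra.
have h0 : 0 < h by rewrite invr_gt0 mulr_gt0.
have hD : (2 * K + L + 1) * h = 2^-1 by rewrite /h; field; rewrite gt_eqF.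
have h1 : h <= 1 by nra.
have h01 : 0 < h <= 1 by rewrite h0 h1.
have := close h b h01; have := close h (b - h) h01.
rewrite db dbh// sub0r normrN => a1 a2.
have := lip (b - h) h (ltW h0); rewrite subrK => a3.
have := ler_norm (1 - dist_fun P X b); have := ler_norm (dist_fun P X (b - h)).
by nra.
Qed.

End accompanying_laws.

(** * From distribution functions to the Kolmogorov distance *)

Lemma cdf_dist_fun (R : realType) d (T : measurableType d) (P : probability T R)
  (X : {RV P >-> R}) x : cdf X x = (dist_fun P X x)%:E.
Proof. by rewrite /dist_fun fineK// fin_num_measure//; exact: measurable_funPTI. Qed.

Theorem proposition4p4 (R : realType)
  (d : measure_display) (T : measurableType d) (P : probability T R)
  (X : {RV P >-> R}) (b : R)
  (nu : {measure set (measurableTypeR R) -> \bar R})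
  (C p : R)
  (dn : nat -> measure_display) (Tn : forall n : nat, measurableType (dn n))
  (Pn : forall n : nat, probability (Tn n) R)
  (Xn : forall n : nat, {RV (Pn n) >-> R}) :
  is_ID X b nu ->
  nondegenerate X ->
  ('E_P[(fun w => `|X w| ^+ 2)%R] < +oo)%E ->
  0 < C ->
  1 <= p ->
  (forall t : R,
    ((cmod (char_fun X t))%:E *
       \int[lebesgue_measure]_(s in `[0%R, `|t|%R]) ((cmod (char_fun X s))^-1)%:E
     <= (C * `|t| `^ p)%:E)%E) ->
  has_bounded_density X ->
  (forall n : nat, (1 <= n)%N ->
    compound_poisson (Xn n) /\
    forall t : R,
      char_fun (Xn n) t = cexp (n%:R * (ID_cf_root b nu n t - 1))) ->
  exists C' : R, 0 < C' /\
    forall n : nat, (1 <= n)%N ->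
      (kolmogorov_dist (Xn n) X <=
        (C' * (n%:R^-1) `^ ((p + 4)^-1))%:E *
        (`|'E_P[X]| + \int[nu]_u (u ^+ 2)%:E) `^ (2 / (p + 4)))%E.
Proof.
move=> XID _ _ _ p1 _ Xdens Xncf.
have p4 : 0 < p + 4 by lra.
have q0 : 0 < (p + 4)^-1 by rewrite invr_gt0.
have r0 : 2 / (p + 4) != 0 by rewrite mulf_neq0 ?gt_eqF.
have I0 : (0 <= \int[nu]_u (u ^+ 2)%:E)%E.
  by apply: integral_ge0 => u _; rewrite lee_fin sqr_ge0.
have N0 (n : nat) : (1 <= n)%N -> 0 < (n%:R^-1 : R) by move=> n1; rewrite invr_gt0 ltr0n.
set M := (`|'E_P[X]| + \int[nu]_u (u ^+ 2)%:E)%E.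
have IM : (\int[nu]_u (u ^+ 2)%:E <= M)%E by rewrite leeDr.
(* If M is infinite, so is the right-hand side, because its exponent is nonzero and its other factor
   is positive; the constant 1 then serves. *)
have [My|/negP] := boolP (M == +oo)%E.
  exists 1; split => // n n1; rewrite (eqP My) poweRyr// mul1r gt0_muley ?leey//.
  by rewrite lte_fin powR_gt0// N0.
rewrite -[_ == _]negbK -ltey => /negP; rewrite negbK => Mlt.
have [S nuS] : exists S : R, (\int[nu]_u (u ^+ 2)%:E)%E = S%:E.
  exists (fine (\int[nu]_u (u ^+ 2)%:E)%E); rewrite fineK// ge0_fin_numE//.
  exact: le_lt_trans IM Mlt.
have S0 : 0 < S := levy_variance_gt0 XID nuS Xdens.
have [k Mk] : exists k : R, M = k%:E.
  by exists (fine M); rewrite fineK// ge0_fin_numE// (le_trans I0).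
have k0 : 0 < k by move: IM; rewrite nuS Mk lee_fin; exact: lt_le_trans.
have [L L0 lip] := bounded_density_lipschitz Xdens.
have [K K0 rate] := accompanying_rate XID nuS L0 lip.
have kr0 : 0 < k `^ (2 / (p + 4)) by exact: powR_gt0.
(* The power of M is positive and independent of n, so it can be divided out; K n^(-1/5) <= K
   n^(-1/(p+4)) is left. *)
exists (K / k `^ (2 / (p + 4))); split; first by rewrite divr_gt0.
move=> n n1; rewrite Mk poweR_EFin -EFinM mulrAC divfK ?gt_eqF//.
apply: ge_ereal_sup => _ [x _ <-].
rewrite !cdf_dist_fun -EFinB abse_EFin lee_fin.
apply: (le_trans (rate n _ _ _ (Xn n) n1 (Xncf n n1).2 x)).
(* As 1 / n <= 1 has a nonpositive logarithm, its powers decrease with the exponent, and 1 / (p + 4)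
   <= 1/5 for p >= 1. *)
rewrite ler_pM2l// /powR !gt_eqF ?N0// ler_expR ler_wnM2r//.
  by rewrite ln_le0// invf_le1 ?ltr0n// ler1n.
by rewrite lef_pV2 ?posrE//; lra.
Qed.
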